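(* Consider functions $S(t,\tau,y)$ and $h(t,\tau,y)$, with $t,\tau\in\mathbb{R}$ and $y\in\mathbb{R}^n$, satisfying the following two separate systems of equations: System for $S$: $$\check K_1^{\varepsilon}(y)\,\partial_tS(t,\tau,y)+\check K_2^{\varepsilon}(y)\cdot\nabla_yS(t,\tau,y)=1,$$ $$\check K_1^{\varepsilon}(y)\,\partial_\tau S(t,\tau,y)+\Big(\check K_1^{\varepsilon}(y)\check G_2^{\varepsilon}(y)-\check G_1^{\varepsilon}(y)\check K_2^{\varepsilon}(y)\Big)\cdot\nabla_yS(t,\tau,y)=-\check G_1^{\varepsilon}(y),$$ $$S(0,0,y)=0;$$ System for $h$: $$\check K_1^{\varepsilon}(y)\,\partial_th(t,\tau,y)+\check K_2^{\varepsilon}(y)\cdot\nabla_yh(t,\tau,y)=0,$$ $$\check K_1^{\varepsilon}(y)\,\partial_\tau h(t,\tau,y)+\Big(\check K_1^{\varepsilon}(y)\check G_2^{\varepsilon}(y)-\check G_1^{\varepsilon}(y)\check K_2^{\varepsilon}(y)\Big)\cdot\nabla_yh(t,\tau,y)=0,$$ $$h(0,0,y)=f_0(y).$$ If the function $y\mapsto\check K_1^{\varepsilon}(y)$ does not vanish, then the following statements hold: (i) the system for $h$ has a unique solution $h$, periodic with respect to $\tau$; (ii) the system for $S$ has a unique solution $S$, periodic with respect to $\tau$; (iii) the formal expansion of the solution $f(t,y)$ of the problem $$\partial_tf(t,y)+\Big(\tfrac1\varepsilon\,\omega(y)G(y)+K(y)\Big)\cdot\nabla_yf(t,y)=0,\qquad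 f(0,y)=f_0(y),$$ satisfies $$f(t,y)=h(t,\tau(t,y),y),$$ where the function $(t,y)\mapsto\tau(t,y)\in\mathbb{R}$ is implicitly defined (locally) by the relation $$\varepsilon\,\tau(t,y)=S(t,\tau(t,y),y).$$
   Context: Setting: $\varepsilon>0$ is a small parameter; $G$ and $K$ are smooth vector fields on $\mathbb{R}^n$; $\omega:\mathbb{R}^n\to\mathbb{R}$ is a smooth scalar function bounded from below by a positive constant; $G$ generates a $2\pi$-periodic flow, with period independent of the initial condition; $f_0$ is smooth. Augmented field: with $Y=(t,y)\in\mathbb{R}^{1+n}$, set $$\check F^{\varepsilon}(Y)=\frac1\varepsilon\check G(Y)+\check K(Y),\qquad \check G(Y)=\begin{pmatrix}0\\ G(y)\end{pmatrix},\qquad \check K(Y)=\begin{pmatrix}\frac1{\omega(y)}\\ \frac1{\omega(y)}K(y)\end{pmatrix}.$$ Then $\check G$ generates a $2\pi$-periodic flow on $\mathbb{R}^{1+n}$. Normal form: $\check G^{\varepsilon},\check K^{\varepsilon}$ denote the vector fields on $\mathbb{R}^{1+n}$ (formal power series in $\varepsilon$) obtained by stroboscopic averaging of $\check F^{\varepsilon}$, such that $\check F^{\varepsilon}=\frac1\varepsilon\check G^{\varepsilon}+\check K^{\varepsilon}$, $[\check G^{\varepsilon},\check K^{\varepsilon}]=0$ (where $[A,B]=(\partial_YA)B-(\partial_YB)A$), and $\check G^{\varepsilon}$ generates a $2\pi$-periodic flow regardless of the trajectory. Like $\check G$ and $\check K$, they depend on $Y=(t,y)$ only through $y$. Index $1$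 denotes the first (scalar, i.e. $t$-) component, index $2$ denotes all the remaining ($y$-) components, so that $\check K^{\varepsilon}=(\check K_1^{\varepsilon},\check K_2^{\varepsilon})$ and $\check G^{\varepsilon}=(\check G_1^{\varepsilon},\check G_2^{\varepsilon})$ with $\check K_1^{\varepsilon},\check G_1^{\varepsilon}$ real-valued and $\check K_2^{\varepsilon},\check G_2^{\varepsilon}$ $\mathbb{R}^n$-valued. Conventions: statements involving $\check G^{\varepsilon},\check K^{\varepsilon}$ are understood formally in $\varepsilon$, i.e. the error terms from truncating the series are neglected and the following properties of $\check G^{\varepsilon},\check K^{\varepsilon}$ are treated as exact: the decomposition $\check F^{\varepsilon}=\frac1\varepsilon\check G^{\varepsilon}+\check K^{\varepsilon}$, the commutation $[\check G^{\varepsilon},\check K^{\varepsilon}]=0$, the $2\pi$-periodicity of the flow of $\check G^{\varepsilon}$ regardless of the trajectory, and the dependence of $\check G^{\varepsilon},\check K^{\varepsilon}$ on $Y=(t,y)$ only through $y$. Flows are assumed to be defined for all times, in particular those of the fields $\frac{1}{\check K_1^{\varepsilon}}\check K_2^{\varepsilon}$ and $\check G_2^{\varepsilon}-\frac{\check G_1^{\varepsilon}}{\check K_1^{\varepsilon}}\check K_2^{\varepsilon}$ on $\mathbb{R}^n$. Solutions are understood to be smooth. *)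

(* Defs.v *)
From HB Require Import structures.
From mathcomp Require Import all_boot all_order all_algebra.
From mathcomp Require Import all_classical all_reals all_analysis.

Set Implicit Arguments.
Unset Strict Implicit.
Unset Printing Implicit Defensive.

Import Order.TTheory GRing.Theory Num.Theory.
Import numFieldNormedType.Exports.

Local Open Scope classical_set_scope.
Local Open Scope ring_scope.

Section Smooth.
Context {R : realType} {V W : normedModType R}.

(* C^oo regularity, for V finite-dimensional: every iterated directional
   derivative of f is Frechet differentiable at every point of A. Only meant
   for an open A, since the derivatives look at f around the points of A. *)
Definition smooth_on (A : set V) (f : V -> W) : Prop :=
  forall (vs : seq V) (x : V), A x ->
    differentiable (foldr (fun v (g : V -> W) => 'D_v g) f vs) x.

Definition smooth (f : V -> W) : Prop := smooth_on setT f.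

End Smooth.

Section Flow.
Context {R : realType} {V : normedModType R}.

(* phi is a flow of X defined for all times; as usual for smooth vector
   fields, a flow is smooth jointly in time and initial condition. *)
Definition is_flow (X : V -> V) (phi : R -> V -> V) : Prop :=
  [/\ smooth (fun p : R * V => phi p.1 p.2),
      forall x, phi 0 x = x
    & forall (t : R) x, is_derive t (1 : R) (phi ^~ x) (X (phi t x))].

Definition generates_flow (X : V -> V) : Prop := exists phi, is_flow X phi.

(* The period 2 pi is common to all trajectories (not necessarily minimal). *)
Definition generates_2pi_periodic_flow (X : V -> V) : Prop :=
  exists2 phi, is_flow X phi & forall t x, phi (t + 2 * pi) x = phi t x.

Definition lie_bracket (A B : V -> V) (x : V) : V :=
  'd A x (B x) - 'd B x (A x).

(* On U, tau is the function with values in J implicitly defined by the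
   relation E x s between x and s. *)
Definition implicit_function (E : V -> R -> Prop) (U : set V) (J : set R)
    (tau : V -> R) : Prop :=
  [/\ open U, open J, smooth_on U tau,
      forall x, U x -> J (tau x)
    & forall x s, U x -> J s -> (E x s <-> s = tau x)].

End Flow.

Section Averaging.
Context {R : realType} {n : nat}.
Notation Rn := 'rV[R]_n.

Definition grad (u : Rn -> R) (y : Rn) : Rn :=
  \row_(i < n) 'D_(delta_mx 0 i) u y.

Definition dotp (a b : Rn) : R := \sum_(i < n) a 0 i * b 0 i.

(* A vector field on R^(1+n) = R * Rn depending on Y = (t, y) only through y is
   given by a map X : Rn -> R * Rn; its components of indices 1 and 2 are then
   (X y).1 and (X y).2. *)
Definition augmented (X : Rn -> R * Rn) (Y : R * Rn) : R * Rn := X Y.2.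

Definition Gcheck (G : Rn -> Rn) (y : Rn) : R * Rn := (0, G y).

Definition Kcheck (omega : Rn -> R) (K : Rn -> Rn) (y : Rn) : R * Rn :=
  ((omega y)^-1, (omega y)^-1 *: K y).

Definition Fcheck (eps : R) (omega : Rn -> R) (G K : Rn -> Rn) (y : Rn) :
    R * Rn :=
  eps^-1 *: Gcheck G y + Kcheck omega K y.

Definition transport_field (eps : R) (omega : Rn -> R) (G K : Rn -> Rn)
    (y : Rn) : Rn :=
  (eps^-1 * omega y) *: G y + K y.

Definition t_field (Ke : Rn -> R * Rn) (y : Rn) : Rn :=
  (Ke y).1^-1 *: (Ke y).2.

Definition tau_field (Ge Ke : Rn -> R * Rn) (y : Rn) : Rn :=
  (Ge y).2 - ((Ge y).1 / (Ke y).1) *: (Ke y).2.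

Definition solves_S_system (Ge Ke : Rn -> R * Rn) (S : R -> R -> Rn -> R) :
    Prop :=
  [/\ smooth (fun p : R * R * Rn => S p.1.1 p.1.2 p.2),
      forall t tau y,
        (Ke y).1 * derive1 (fun s => S s tau y) t
        + dotp (Ke y).2 (grad (S t tau) y) = 1,
      forall t tau y,
        (Ke y).1 * derive1 (fun s => S t s y) tau
        + dotp ((Ke y).1 *: (Ge y).2 - (Ge y).1 *: (Ke y).2)
               (grad (S t tau) y) = - (Ge y).1
    & forall y, S 0 0 y = 0].

Definition solves_h_system (Ge Ke : Rn -> R * Rn) (f0 : Rn -> R)
    (h : R -> R -> Rn -> R) : Prop :=
  [/\ smooth (fun p : R * R * Rn => h p.1.1 p.1.2 p.2),
      forall t tau y,
        (Ke y).1 * derive1 (fun s => h s tau y) t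
        + dotp (Ke y).2 (grad (h t tau) y) = 0,
      forall t tau y,
        (Ke y).1 * derive1 (fun s => h t s y) tau
        + dotp ((Ke y).1 *: (Ge y).2 - (Ge y).1 *: (Ke y).2)
               (grad (h t tau) y) = 0
    & forall y, h 0 0 y = f0 y].

Definition solves_transport (eps : R) (omega : Rn -> R) (G K : Rn -> Rn)
    (f0 : Rn -> R) (f : R -> Rn -> R) : Prop :=
  [/\ smooth (fun p : R * Rn => f p.1 p.2),
      forall t y,
        derive1 (fun s => f s y) t
        + dotp (transport_field eps omega G K y) (grad (f t) y) = 0
    & forall y, f 0 y = f0 y].

Definition tau_periodic (u : R -> R -> Rn -> R) : Prop :=
  forall t tau y, u t (tau + 2 * pi) y = u t tau y.

End Averaging.

(* Main.v *)
Require Import Defs.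
From HB Require Import structures.
From mathcomp Require Import all_boot all_order all_algebra.
From mathcomp Require Import all_classical all_reals all_analysis.
From mathcomp Require Import ring lra.
Import Order.TTheory GRing.Theory Num.Theory.
Import numFieldNormedType.Exports.

Local Open Scope classical_set_scope.
Local Open Scope ring_scope.

(** Write K = (a, A) and G = (g, B) for the averaged fields, and put X = A / a,
    Z = B - g X and p = 1 / a, q = - g / a. Divided by a, the two systems become

      u_t + X u = p',     u_tau + Z u = q',     u (0, 0, .) = u0

    with (p', q', u0) = (0, 0, f0) for h and (p, q, 0) for S. The relation
    [G, K] = 0 says exactly that X and Z commute (commuting_fields) and that
    X q = Z p (S_rhs_compatible), which is the integrability condition of the
    overdetermined system.

    Existence: integrate along Z, then along X, by Duhamel's formula
    (solves_exists). The equation for Z survives the transport along X because the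
    flow of X carries commuting fields to themselves (flow_push). That fact
    follows from the uniqueness theorem for linear differential equations and the
    exchange of time and space derivatives. The Duhamel term needs the smooth
    dependence of integrals on parameters (smooth_int01), from which the exchange
    of derivatives follows as well (mixed_derivative).

    Uniqueness: u is determined along the characteristics (solves_unique).

    Periodicity: B = g X + Z, so that along the flow of G, with t following its first
    component and tau the elapsed time, u changes at the rate g p' + q' = 0. After
    one period only tau has changed (solves_periodic).

    Recovering f: the decomposition of the original field reads a + g / eps =
    1 / omega, together with its y-part, and gives

      omega G / eps + K = X + (omega / eps) Z,     p + (omega / eps) q = omega

    for the unaveraged G and K on the left. The orbits of the averaged G being
    closed, g vanishes somewhere on each of them, whence a > 0 (Ke1_gt0). Then
    eps tau - S has the positive tau-derivative eps / (omega a), evaluated at a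
    point of another trajectory, and it takes both signs by periodicity of S: the
    relation eps tau = S (t, tau, y) has exactly one solution, globally and not only
    locally, and it is smooth by the implicit function theorem (implicit_smooth).
    Along a trajectory of the original field, eps tau - S = 0 forces tau to move at
    the rate omega / eps; hence (t, tau, y) moves in a characteristic direction of h
    and h keeps its value, which is f0 at the starting point (reconstruction). *)

Set Implicit Arguments.
Unset Strict Implicit.
Unset Printing Implicit Defensive.

(** * Calculus of smooth functions *)

Section SmoothCalculus.
Context {R : realType}.
Implicit Types U V W : normedModType R.

(** The class of k + 1 times differentiable functions. Smoothness is the
    intersection of these classes, and each closure property below is an
    induction on k: the derivative of a sum, product or composite is again a
    sum of products of composites, of one order less. Unfolding smooth along
    lists of directions would not give such an induction, since the derived
    expression changes shape at every step. *)
Fixpoint Ck (k : nat) V W (f : V -> W) : Prop :=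
  (forall x, differentiable f x) /\
  (if k is k'.+1 then forall v, Ck k' ('D_v f) else True).

Lemma Ck_diff k V W (f : V -> W) x : Ck k f -> differentiable f x.
Proof. by case: k => [|k] [df _]; exact: df. Qed.

Lemma CkS_derive k V W (f : V -> W) v : Ck k.+1 f -> Ck k ('D_v f).
Proof. by case=> _; exact. Qed.

Lemma CkW k V W (f : V -> W) : Ck k.+1 f -> Ck k f.
Proof.
elim: k V W f => [|k IH] V W f [df Df]; split=> // v.
exact/IH/Df.
Qed.

Lemma smooth_diff V W (f : V -> W) x : smooth f -> differentiable f x.
Proof. by move=> /(_ [::] x); apply. Qed.

Lemma smooth_derive V W (f : V -> W) v : smooth f -> smooth ('D_v f).
Proof.
move=> sf vs x _; have := sf (rcons vs v) x I.
by rewrite foldr_rcons.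
Qed.

Lemma smooth_Ck V W (f : V -> W) : smooth f <-> forall k, Ck k f.
Proof.
split=> [sf k|].
  elim: k V W f sf => [|k IH] V W f sf;
  (split; first by move=> x; exact: smooth_diff) => // v.
  exact/IH/smooth_derive.
move=> Cf vs x _; elim/last_ind: vs f Cf => [|vs v IH] f Cf /=.
  exact: (Ck_diff _ (Cf 0)).
by rewrite foldr_rcons; apply: IH => k; apply: CkS_derive.
Qed.

Lemma Ck_cst k V W (a : W) : Ck k (fun _ : V => a).
Proof.
elim: k V W a => [|k IH] V W a;
  (split; first by move=> x; exact: differentiable_cst) => // v.
suff -> : 'D_v (fun=> a) = (fun=> 0) :> (V -> W) by exact: IH.
by apply/funext => x; rewrite derive_cst.
Qed.

Lemma CkD k V W (f g : V -> W) : Ck k f -> Ck k g -> Ck k (fun x => f x + g x).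
Proof.
elim: k f g => [|k IH] f g Cf Cg;
  (split; first by move=> x; apply: differentiableD; apply: Ck_diff; eassumption) => // v.
have -> : 'D_v (fun x => f x + g x) = (fun x => 'D_v f x + 'D_v g x).
  apply/funext => x; rewrite -deriveD//; exact/diff_derivable/(Ck_diff _ (k := k.+1)).
by apply: IH; apply: CkS_derive.
Qed.

Lemma Ck_linear_comp k V W W' (l : {linear W -> W'}) (f : V -> W) :
  continuous l -> Ck k f -> Ck k (fun x => l (f x)).
Proof.
move=> cl; elim: k f => [|k IH] f Cf;
  (split; first by move=> x; apply: (@differentiable_comp _ _ _ _ f l);
    [apply: Ck_diff; eassumption|exact: linear_differentiable]) => // v.
suff -> : 'D_v (fun x => l (f x)) = (fun x => l ('D_v f x)).
  by apply: IH; apply: CkS_derive.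
apply/funext => x; have df : differentiable f x := Ck_diff _ Cf.
have dl y : differentiable l y by exact: linear_differentiable.
rewrite !deriveE//; last by apply: (@differentiable_comp _ _ _ _ f l).
by rewrite (@diff_comp _ _ _ _ f l)// diff_lin.
Qed.

Lemma Ck_linear k V W (l : {linear V -> W}) : continuous l -> Ck k l.
Proof.
move=> cl; case: k => [|k];
  (split; first by move=> x; exact: linear_differentiable) => // v.
suff -> : 'D_v l = (fun=> l v) by exact: Ck_cst.
apply/funext => x; rewrite deriveE ?diff_lin//; exact: linear_differentiable.
Qed.

(** Through bilinearity the product rule covers scalar functions times
    vector-valued ones, so that the same closure lemma serves functions and
    vector fields. *)
Lemma scale_bilinear W : bilinear_for
    (GRing.Scale.Law.clone _ _ *:%R _) (GRing.Scale.Law.clone _ _ *:%R _)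
    ( *:%R : R -> W -> W).
Proof.
split=> [u'|u] a x y /=.
- by rewrite scalerDl scalerA.
- by rewrite scalerDr !scalerA mulrC.
Qed.

Definition scaleb (W : normedModType R) : R -> W -> W := *:%R.
HB.instance Definition _ W := bilinear_isBilinear.Build R R W W _ _ (@scaleb W)
  (@scale_bilinear W).

Lemma scaleb_continuous W : continuous (fun p : R * W => scaleb p.1 p.2).
Proof. move=> p; exact: scale_continuous. Qed.

Lemma differentiable_scale V W (f : V -> R) (g : V -> W) x :
  differentiable f x -> differentiable g x ->
  differentiable (fun x => f x *: g x) x.
Proof.
move=> df dg.
apply: (@differentiable_comp _ _ _ _ (fun x => (f x, g x)) (fun p => scaleb p.1 p.2)).
  exact: differentiable_pair.
exact/differentiable_bilin/scaleb_continuous.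
Qed.

Lemma derive_scale V W (f : V -> R) (g : V -> W) x v :
  differentiable f x -> differentiable g x ->
  'D_v (fun x => f x *: g x) x = f x *: 'D_v g x + 'D_v f x *: g x.
Proof.
move=> df dg; rewrite !deriveE//; last exact: differentiable_scale.
rewrite (@diff_comp _ _ _ _ (fun x => (f x, g x)) (fun p => scaleb p.1 p.2));
  [|exact: differentiable_pair|exact/differentiable_bilin/scaleb_continuous].
rewrite /= diff_bilin; last exact: scaleb_continuous.
by rewrite diff_pair.
Qed.

Lemma CkZ k V W (f : V -> R) (g : V -> W) :
  Ck k f -> Ck k g -> Ck k (fun x => f x *: g x).
Proof.
elim: k f g => [|k IH] f g Cf Cg;
  (split; first by move=> x; apply: differentiable_scale; apply: Ck_diff; eassumption) => // v.
have -> : 'D_v (fun x => f x *: g x) = (fun x => f x *: 'D_v g x + 'D_v f x *: g x).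
  apply/funext => x; rewrite derive_scale//; apply: Ck_diff; eassumption.
by apply: CkD; apply: IH; do ?[exact: CkW | exact: CkS_derive].
Qed.

Lemma Ck_sum k V W m (f : 'I_m -> V -> W) :
  (forall i, Ck k (f i)) -> Ck k (fun x => \sum_(i < m) f i x).
Proof.
elim: m f => [|m IH] f Cf.
  by under eq_fun do rewrite big_ord0; exact: Ck_cst.
under eq_fun do rewrite big_ord_recl.
by apply: CkD; [|apply: IH].
Qed.

Lemma Ck_pair k U V W (f : U -> V) (g : U -> W) :
  Ck k f -> Ck k g -> Ck k (fun x => (f x, g x)).
Proof.
elim: k f g => [|k IH] f g Cf Cg;
  (split; first by move=> x; apply: differentiable_pair; apply: Ck_diff; eassumption) => // v.
have -> : 'D_v (fun x => (f x, g x)) = (fun x => ('D_v f x, 'D_v g x)).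
  apply/funext => x.
  have df : differentiable f x := Ck_diff _ Cf.
  have dg : differentiable g x := Ck_diff _ Cg.
  by rewrite !deriveE ?diff_pair//; exact: differentiable_pair.
by apply: IH; exact: CkS_derive.
Qed.

Lemma Ck_inv k V (f : V -> R) : (forall x, f x != 0) -> Ck k f -> Ck k (fun x => (f x)^-1).
Proof.
move=> f0; elim: k => [|k IH] Cf;
  (split; first by move=> x; apply: differentiableV => //; apply: Ck_diff; eassumption) => // v.
have -> : 'D_v (fun x => (f x)^-1) = (fun x => ((-1) * ((f x)^-1 * (f x)^-1)) *: 'D_v f x).
  apply/funext => x; rewrite deriveV//; last exact/diff_derivable/(Ck_diff _ Cf).
  by rewrite mulN1r -invfM -expr2.
apply: CkZ; last exact: CkS_derive.
apply: (CkZ (f := fun=> -1)); first exact: Ck_cst.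
by apply: CkZ; apply/IH/CkW.
Qed.

(** Finite dimension, given by a basis and continuous coordinates. It makes
    finitely many directional derivatives determine the differential: the
    chain rule can then be written with the derivatives of the outer function
    along the basis. *)
Definition coordinatized V :=
  exists m (e : 'I_m -> V) (c : 'I_m -> {linear V -> R}),
    (forall i, continuous (c i)) /\ forall v, v = \sum_(i < m) c i v *: e i.

(** In coordinates D_v (g o f) is a finite sum of products of a component of
    D_v f with some (D_e g) o f, where the induction hypothesis applies. *)
Lemma Ck_comp k U V W (f : U -> V) (g : V -> W) : coordinatized V ->
  Ck k f -> Ck k g -> Ck k (fun x => g (f x)).
Proof.
move=> [m [e [c [cc ce]]]]; elim: k f g => [|k IH] f g Cf Cg;
  (split; first by move=> x; apply: (@differentiable_comp _ _ _ _ f g);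
    apply: Ck_diff; eassumption) => // v.
have -> : 'D_v (fun x => g (f x)) =
    (fun x => \sum_(i < m) c i ('D_v f x) *: 'D_(e i) g (f x)).
  apply/funext => x.
  have df : differentiable f x := Ck_diff _ Cf.
  have dg y : differentiable g y := Ck_diff _ Cg.
  rewrite deriveE; last exact: (@differentiable_comp _ _ _ _ f g).
  rewrite (@diff_comp _ _ _ _ f g)//= -(deriveE v df) {1}(ce ('D_v f x)) linear_sum.
  by apply: eq_bigr => i _; rewrite linearZ -(deriveE _ (dg _)).
apply: Ck_sum => i; apply: CkZ.
  by apply: Ck_linear_comp => //; exact: CkS_derive.
by apply: (IH f ('D_(e i) g)); [exact: CkW|exact: CkS_derive].
Qed.


Lemma smooth_cst V W (a : W) : smooth (fun _ : V => a).
Proof. by apply/smooth_Ck => k; exact: Ck_cst. Qed.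

Lemma smoothD V W (f g : V -> W) :
  smooth f -> smooth g -> smooth (fun x => f x + g x).
Proof.
by move=> /smooth_Ck sf /smooth_Ck sg; apply/smooth_Ck => k; exact: CkD.
Qed.

Lemma smoothZ V W (f : V -> R) (g : V -> W) :
  smooth f -> smooth g -> smooth (fun x => f x *: g x).
Proof.
by move=> /smooth_Ck sf /smooth_Ck sg; apply/smooth_Ck => k; exact: CkZ.
Qed.

Lemma smoothM V (f g : V -> R) :
  smooth f -> smooth g -> smooth (fun x => f x * g x).
Proof. exact: smoothZ. Qed.

Lemma smoothN V W (f : V -> W) : smooth f -> smooth (fun x => - f x).
Proof.
move=> sf; rewrite (_ : (fun _ => _) = (fun x => (-1) *: f x)).
  by apply: smoothZ => //; exact: smooth_cst.
by apply/funext => x; rewrite scaleN1r.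
Qed.

Lemma smoothB V W (f g : V -> W) :
  smooth f -> smooth g -> smooth (fun x => f x - g x).
Proof. by move=> sf sg; apply: smoothD => //; exact: smoothN. Qed.

Lemma smoothV V (f : V -> R) :
  (forall x, f x != 0) -> smooth f -> smooth (fun x => (f x)^-1).
Proof.
by move=> f0 /smooth_Ck sf; apply/smooth_Ck => k; exact: Ck_inv.
Qed.

Lemma smooth_pair U V W (f : U -> V) (g : U -> W) :
  smooth f -> smooth g -> smooth (fun x => (f x, g x)).
Proof.
by move=> /smooth_Ck sf /smooth_Ck sg; apply/smooth_Ck => k; exact: Ck_pair.
Qed.

Lemma smooth_comp U V W (f : U -> V) (g : V -> W) : coordinatized V ->
  smooth f -> smooth g -> smooth (fun x => g (f x)).
Proof.
move=> cV /smooth_Ck sf /smooth_Ck sg; apply/smooth_Ck => k; exact: Ck_comp.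
Qed.

Lemma smooth_linear V W (l : {linear V -> W}) : continuous l -> smooth l.
Proof. by move=> cl; apply/smooth_Ck => k; exact: Ck_linear. Qed.

Lemma smooth_linear_comp V W W' (l : {linear W -> W'}) (f : V -> W) :
  continuous l -> smooth f -> smooth (fun x => l (f x)).
Proof.
by move=> cl /smooth_Ck sf; apply/smooth_Ck => k; exact: Ck_linear_comp.
Qed.

Lemma smooth_id V : smooth (fun x : V => x).
Proof. by apply: (smooth_linear (l := idfun)) => x; exact: cvg_id. Qed.

(** Named copies of the projections and coordinates, which can carry the
    structure of linear maps. *)
Definition lfst V W : V * W -> V := fst.
Definition lsnd V W : V * W -> W := snd.
HB.instance Definition _ V W := GRing.isLinear.Build R (V * W)%type V _ (@lfst V W)
  (fun a x y => erefl).
HB.instance Definition _ V W := GRing.isLinear.Build R (V * W)%type W _ (@lsnd V W)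
  (fun a x y => erefl).

Lemma smooth_fst U V W (f : U -> V * W) : smooth f -> smooth (fun x => (f x).1).
Proof.
by move=> sf; apply: (smooth_linear_comp (l := @lfst V W)) => // x; exact: cvg_fst.
Qed.

Lemma smooth_snd U V W (f : U -> V * W) : smooth f -> smooth (fun x => (f x).2).
Proof.
by move=> sf; apply: (smooth_linear_comp (l := @lsnd V W)) => // x; exact: cvg_snd.
Qed.

Definition lcoord m n i j (M : 'M[R]_(m, n)) : R := M i j.
Lemma lcoord_linear m n i j : linear (@lcoord m n i j).
Proof. by move=> a x y; rewrite /lcoord !mxE. Qed.
HB.instance Definition _ m n i j :=
  GRing.isLinear.Build R 'M[R]_(m, n) R _ (@lcoord m n i j) (lcoord_linear i j).

Lemma smooth_coord U m n (f : U -> 'M[R]_(m, n)) i j :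
  smooth f -> smooth (fun x => f x i j).
Proof.
move=> sf; apply: (smooth_linear_comp (l := @lcoord m n i j)) => //.
exact: coord_continuous.
Qed.

Lemma coordinatized_R : coordinatized (R : normedModType R).
Proof.
exists 1%N, (fun=> 1), (fun=> idfun); split=> [i x|v]; first exact: cvg_id.
by rewrite big_ord1 [LHS](esym (mulr1 _)).
Qed.

Lemma coordinatized_rV n : coordinatized ('rV[R]_n : normedModType R).
Proof.
exists n, (fun i => delta_mx 0 i), (fun i => @lcoord 1 n 0 i).
split=> [i|v]; last exact: row_sum_delta.
exact: coord_continuous.
Qed.

Lemma coordinatized_prod V W :
  coordinatized V -> coordinatized W -> coordinatized (V * W)%type.
Proof.
move=> [m [e [c [cc ce]]]] [n [e' [c' [cc' ce']]]].
pose c1 i : {linear (V * W)%type -> R} := c i \o @lfst V W.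
pose c2 i : {linear (V * W)%type -> R} := c' i \o @lsnd V W.
exists (m + n)%N,
  (fun i => match fintype.split i with inl i => (e i, 0) | inr i => (0, e' i) end),
  (fun i => match fintype.split i with inl i => c1 i | inr i => c2 i end); split.
  move=> i; case: fintype.split => j x; apply: continuous_comp.
  - exact: cvg_fst.
  - exact: cc.
  - exact: cvg_snd.
  - exact: cc'.
move=> [v w]; rewrite big_split_ord /=.
under eq_bigr do rewrite (unsplitK (inl _)) /=.
under [X in _ + X]eq_bigr do rewrite (unsplitK (inr _)) /=.
rewrite [in LHS](ce v) [in LHS](ce' w).
have -> (a : V) (b : W) : (a, b) = (a, 0) + (0, b).
  by congr pair; rewrite /= ?addr0 ?add0r.
rewrite -[X in X + _](_ : \sum_(i < m) (c i v *: e i, 0) = _); last first.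
  elim/big_rec2 : _ => // i a b _ ->.
  by congr pair; rewrite /= addr0.
rewrite -[X in _ + X](_ : \sum_(i < n) (0, c' i w *: e' i) = _); last first.
  elim/big_rec2 : _ => // i a b _ ->.
  by congr pair; rewrite /= addr0.
congr (_ + _); apply: eq_bigr => i _; congr pair; rewrite /= scaler0//.
Qed.

End SmoothCalculus.

(** * Derivatives along curves, and integrals over the unit segment *)

Section Curves.
Context {R : realType}.
Implicit Types U V W : normedModType R.

Lemma is_derive_curve V W (u : V -> W) (c : R -> V) s (c' : V) :
  differentiable u (c s) -> is_derive s (1 : R) c c' ->
  is_derive s (1 : R) (fun s => u (c s)) ('D_c' u (c s)).
Proof.
move=> du dc.
have dc1 : differentiable c s by apply/derivable1_diffP; exact: ex_derive.
have duc : differentiable (fun s => u (c s)) s.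
  exact: (@differentiable_comp _ _ _ _ c u).
apply: DeriveDef; first exact: diff_derivable.
rewrite deriveE// (@diff_comp _ _ _ _ c u)//= -(deriveE _ dc1) derive_val.
by rewrite deriveE.
Qed.

Lemma is_derive_pair V W (a : R -> V) (b : R -> W) s a' b' :
  is_derive s (1 : R) a a' -> is_derive s (1 : R) b b' ->
  is_derive s (1 : R) (fun s => (a s, b s)) (a', b').
Proof.
move=> da db.
have da1 : differentiable a s by apply/derivable1_diffP; exact: ex_derive.
have db1 : differentiable b s by apply/derivable1_diffP; exact: ex_derive.
apply: DeriveDef; first exact/diff_derivable/differentiable_pair.
rewrite deriveE; last exact: differentiable_pair.
by rewrite diff_pair// -!deriveE// !derive_val.
Qed.

Lemma is_derive_line V (x v : V) (t : R) :
  is_derive t (1 : R) (fun t => t *: v + x) v.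
Proof.
rewrite -[X in is_derive _ _ _ X]addr0; apply: is_deriveD.
have d := is_diff_scalel t v.
apply: DeriveDef; first exact: diff_derivable.
by rewrite deriveE// diff_val scale1r.
Qed.

Lemma is_derive_const V (a : V) (s : R) : is_derive s (1 : R) (fun=> a) (0 : V).
Proof. exact: is_derive_cst. Qed.

Lemma is_derive_mulr (a s : R) : is_derive s (1 : R) (fun s => s * a) a.
Proof. by have := is_derive_line 0 a s; under eq_fun do rewrite addr0. Qed.

Lemma is_derive_mul (f g : R -> R) (s df dg : R) :
  is_derive s (1 : R) f df -> is_derive s (1 : R) g dg ->
  is_derive s (1 : R) (fun s => f s * g s) (f s * dg + g s * df).
Proof. by move=> hf hg; exact: is_deriveM. Qed.

(** Reduces an identity between directional derivatives to an identity between
    functions of one real variable; this is the quickest way through affine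
    changes of variables. *)
Lemma derive_lineE V W (f : V -> W) p v :
  'D_v f p = 'D_1 (fun r : R => f (r *: v + p)) 0.
Proof.
rewrite /derive; set g1 := fun h => h^-1 *: _; set g2 := fun h => h^-1 *: _.
suff -> : g1 = g2 by [].
by rewrite funeqE /g1 /g2 => h /=; rewrite addr0 scale0r add0r [_%:A]mulr1.
Qed.

Lemma derive_fst V W (p v : V * W) : 'D_v fst p = v.1.
Proof.
rewrite derive_lineE /=; have h := is_derive_line p.1 v.1 (0 : R).
exact: derive_val.
Qed.

Lemma derive_snd V W (p v : V * W) : 'D_v snd p = v.2.
Proof.
rewrite derive_lineE /=; have h := is_derive_line p.2 v.2 (0 : R).
exact: derive_val.
Qed.

Lemma is_derive_fst V W (c : R -> V * W) s d :
  is_derive s (1 : R) c d -> is_derive s (1 : R) (fun s => (c s).1) d.1.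
Proof.
move=> dc; rewrite -(derive_fst (c s)); apply: (is_derive_curve (u := fst)) => //.
exact/smooth_diff/smooth_fst/smooth_id.
Qed.

Lemma is_derive_snd V W (c : R -> V * W) s d :
  is_derive s (1 : R) c d -> is_derive s (1 : R) (fun s => (c s).2) d.2.
Proof.
move=> dc; rewrite -(derive_snd (c s)); apply: (is_derive_curve (u := snd)) => //.
exact/smooth_diff/smooth_snd/smooth_id.
Qed.

(** All uniqueness statements about first order equations end here: along a
    characteristic, two solutions have the same derivative. *)
Lemma eq_derive_cst (f g : R -> R) (d : R -> R) a b :
  (forall s, is_derive s (1 : R) f (d s)) ->
  (forall s, is_derive s (1 : R) g (d s)) ->
  f a - f b = g a - g b.
Proof.
move=> df dg.
have : (fun s => f s - g s) a = (fun s => f s - g s) b.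
  apply: (@is_derive_0_is_cst _ (fun s => f s - g s)) => s.
  by rewrite -[0](subrr (d s)); exact: is_deriveB.
move=> /=; lra.
Qed.

(** The epsilon form of differentiability, used for the two functions that are
    not composed of known ones: parametric integrals and implicit functions. *)
Lemma differentiable_bound V W (f : V -> W) x (l : {linear V -> W}) :
  continuous l ->
  (forall e, 0 < e -> \forall v \near (0 : V), `|f (v + x) - f x - l v| <= e * `|v|) ->
  differentiable f x /\ 'd f x = l :> (V -> W).
Proof.
move=> cl fl.
have fE : f \o shift x = cst (f x) + l +o_ (0 : V) id.
  apply/eqaddoP => e /fl; apply: filterS => v.
  by rewrite /= opprD addrA.
have dE := diff_unique cl fE.
split; last exact: dE.
apply/diff_locallyP; rewrite dE; split => //.
Qed.

End Curves.

Section Integral.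
Context {R : realType}.
Implicit Types U V W : normedModType R.

Definition int01 V (F : R * V -> R) (x : V) : R :=
  \int[@lebesgue_measure R]_(s in `[0, 1]) F (s, x).

Lemma continuous_slice V W (F : R * V -> W) x :
  (forall p, differentiable F p) -> continuous (fun s => F (s, x)).
Proof.
move=> dF s; apply/differentiable_continuous.
apply: (@differentiable_comp _ _ _ _ (fun s => (s, x)) F); last exact: dF.
exact: differentiable_pair.
Qed.

Lemma continuous_mul (f g : R -> R) :
  continuous f -> continuous g -> continuous (fun s => f s * g s).
Proof. by move=> cf cg s; exact: (continuousM (cf s) (cg s)). Qed.

Lemma continuous_sub (f g : R -> R) :
  continuous f -> continuous g -> continuous (fun s => f s - g s).
Proof. by move=> cf cg s; exact: (continuousB (cf s) (cg s)). Qed.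

Lemma continuous_add (f g : R -> R) :
  continuous f -> continuous g -> continuous (fun s => f s + g s).
Proof. by move=> cf cg s; exact: (continuousD (cf s) (cg s)). Qed.

Lemma is_derive_slice V W (F : R * V -> W) (s : R) (x : V) :
  differentiable F (s, x) ->
  is_derive s (1 : R) (fun s => F (s, x)) ('D_((1 : R), (0 : V)) F (s, x)).
Proof.
move=> dF; apply: (is_derive_curve (c := fun s : R => (s, x)) (u := F)) => //.
by apply: is_derive_pair.
Qed.

Lemma int01_integrable (f : R -> R) : continuous f ->
  (@lebesgue_measure R).-integrable `[0, 1] (EFin \o f).
Proof.
move=> cf; apply: continuous_compact_integrable; first exact: segment_compact.
exact: continuous_subspaceT.
Qed.

Lemma int01_bound (f : R -> R) (e : R) : continuous f ->
  (forall s, 0 <= s <= 1 -> `|f s| <= e) ->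
  `|\int[@lebesgue_measure R]_(s in `[0, 1]) f s| <= e.
Proof.
move=> cf fe; apply: (le_trans (le_normr_Rintegral _ _)) => //.
  exact: int01_integrable.
apply: (@le_trans _ _ (\int[@lebesgue_measure R]_(s in `[0, 1]) e)).
  apply: le_Rintegral => //.
  - apply: (int01_integrable (f := fun s => `|f s|)) => s.
    apply: (continuous_comp (cf s)); exact: norm_continuous.
  - by apply: (int01_integrable (f := fun s => e)) => s; exact: cvg_cst.
rewrite Rintegral_cst//= lebesgue_measure_itv/= lte_fin ltr01 oppr0 adde0 /=.
by rewrite mulr1.
Qed.

Lemma int01_FTC (f f' : R -> R) : (forall s, is_derive s (1 : R) f (f' s)) ->
  continuous f' -> \int[@lebesgue_measure R]_(s in `[0, 1]) f' s = f 1 - f 0.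
Proof.
move=> df cf'; rewrite /Rintegral (@continuous_FTC2 _ f' f)//.
- exact: continuous_subspaceT.
- have cf s : {for s, continuous f}.
    by apply/differentiable_continuous/derivable1_diffP; exact: ex_derive.
  split; first by move=> s _; exact: ex_derive.
  - exact/cvg_at_right_filter/cf.
  - exact/cvg_at_left_filter/cf.
- by move=> s _; rewrite derive1E derive_val.
Qed.

End Integral.

(** * Integrals depending smoothly on parameters *)

Section Integral.
Context {R : realType}.
Implicit Types U V W : normedModType R.

(** Continuity is uniform over the segment by compactness. *)
Lemma near_segment_uniform V (F : R * V -> R) x (e : R) : continuous F -> 0 < e ->
  \forall v \near (0 : V), forall s, 0 <= s <= 1 -> `|F (s, v + x) - F (s, x)| <= e.
Proof.
move=> cF e0.
have /compact_near_coveringP K : compact (`[0 : R, 1]%classic : set R).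
  exact: segment_compact.
have loc (s : R) : `[0, 1]%classic s ->
    \forall s' \near s & v \near (0 : V), `|F (s', v + x) - F (s', x)| <= e.
  move=> _.
  have e2 : 0 < e / 2 by rewrite divr_gt0.
  have := cF (s, x) => /cvgrPdist_le /(_ _ e2) /nbhs_ballP[d /= d0 dF].
  exists (ball s d, ball (0 : V) d); first by split; exact: nbhsx_ballx.
  move=> [s' v] /= [sd vd].
  have h1 : `|F (s, x) - F (s', v + x)| <= e / 2.
    apply: dF; split => //=.
    by move: vd; rewrite -!ball_normE /= sub0r opprD addrCA subrr addr0.
  have h2 : `|F (s, x) - F (s', x)| <= e / 2.
    by apply: dF; split => //=; exact: ballxx.
  rewrite (_ : F (s', v + x) - F (s', x) =
    - (F (s, x) - F (s', v + x)) + (F (s, x) - F (s', x))); last by ring.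
  rewrite (le_trans (ler_normD _ _))// normrN; lra.
have := K V (nbhs (0 : V)) (fun v s => `|F (s, v + x) - F (s, x)| <= e)
  (nbhs_filter _) loc.
by apply: filterS => v H s s01; apply: H; rewrite /= in_itv.
Qed.

(** By the mean value theorem the remainder F(s, x + v) - F(s, x) - D_v F(s,
    x) is D_v F at an intermediate point minus D_v F at x. Expanding v in the
    basis bounds it by |v| times the variation of finitely many partial
    derivatives, which is small uniformly in s. *)
Lemma int01_diff V (F : R * V -> R) x : coordinatized V -> smooth F ->
  differentiable (int01 F) x /\
  forall v, 'D_v (int01 F) x = int01 ('D_(0, v) F) x.
Proof.
move=> [m [b [c [cc cb]]]] sF.
have dF p : differentiable F p by exact: smooth_diff.
have dDF v p : differentiable ('D_v F) p by exact/smooth_diff/smooth_derive.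
have cs v y : continuous (fun s => 'D_v F (s, y)) by exact: (continuous_slice (F := 'D_v F) (dDF v)).
have cs0 y : continuous (fun s => F (s, y)) by exact: (continuous_slice dF).
pose L v := int01 ('D_(0, v) F) x.
have DF0 (v : V) p : 'D_((0 : R), v) F p = \sum_(i < m) c i v * 'D_(0, b i) F p.
  rewrite {1}(cb v) deriveE// (_ : (0, _) = \sum_(i < m) c i v *: ((0 : R), b i)).
    by rewrite linear_sum; apply: eq_bigr => i _; rewrite linearZ deriveE.
  elim/big_rec2 : _ => // i a d _ <-; congr pair; rewrite /= ?addr0//.
  by rewrite [RHS]mulr0.
have linL : linear L.
  move=> a u v; rewrite /L /int01.
  under eq_Rintegral => s _.
    rewrite deriveE// (_ : (0, a *: u + v) = a *: ((0 : R), u) + (0, v)); last first.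
      by congr pair; rewrite /= ?addr0 [RHS]mulr0.
    rewrite linearD linearZ /= -!deriveE//.
    over.
  rewrite RintegralD//; last 2 first.
  - apply: (int01_integrable (f := fun s => a * 'D_(0, u) F (s, x))).
    by apply: (continuous_mul (f := fun=> a)); [exact: cst_continuous|exact: cs].
  - exact: (int01_integrable (f := fun s => 'D_(0, v) F (s, x))).
  rewrite RintegralZl//.
  exact: (int01_integrable (f := fun s => 'D_(0, u) F (s, x))).
pose LM := GRing.isLinear.Build _ _ _ _ _ linL.
pose LL : {linear V -> R} := HB.pack L LM.
have LE v : LL v = \sum_(i < m) c i v *: LL (b i).
  by rewrite {1}(cb v) linear_sum; apply: eq_bigr => i _; rewrite linearZ.
have cL : continuous LL.
  have -> : (LL : V -> R) = (fun v => \sum_(i < m) c i v *: LL (b i)).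
    by apply/funext => v; exact: LE.
  move=> v; apply/differentiable_continuous/(Ck_diff (k := 0)).
  by apply: Ck_sum => i; apply: CkZ; [exact: Ck_linear|exact: Ck_cst].
suff : differentiable (int01 F) x /\ 'd (int01 F) x = LL :> (V -> R).
  by move=> [dI dE]; split=> // v; rewrite deriveE// dE.
apply: differentiable_bound => // e e0.
have [k kP] : exists k : 'I_m -> R, forall i, 0 < k i /\ forall v, `|c i v| <= k i * `|v|.
  have h i : exists k, 0 < k /\ forall v, `|c i v| <= k * `|v|.
    by have [k k0 kP] := linear_lipschitz (cc i); exists k.
  by exists (fun i => projT1 (cid (h i))) => i; exact: (projT2 (cid (h i))).
pose M := 1 + \sum_(i < m) k i.
have M0 : 0 < M.
  by rewrite ltr_wpDr// sumr_ge0// => i _; rewrite ltW//; case: (kP i).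
have : \forall v \near (0 : V), forall i, forall s, 0 <= s <= 1 ->
   `|'D_(0, b i) F (s, v + x) - 'D_(0, b i) F (s, x)| <= e / M.
  apply: filter_forall => i.
  apply: (near_segment_uniform (F := 'D_(0, b i) F)); last exact: divr_gt0.
  by move=> p; exact/differentiable_continuous.
move=> /nbhs_ballP[d /= d0 dP]; apply/nbhs_ballP; exists d => //= v vd.
rewrite /int01 /LL /= /L /int01 -RintegralB//; last 2 first.
- exact: (int01_integrable (f := fun s => F (s, v + x))).
- exact: (int01_integrable (f := fun s => F (s, x))).
rewrite -RintegralB//; last 2 first.
- apply: (int01_integrable (f := fun s => F (s, v + x) - F (s, x))).
  by apply: continuous_sub; exact: cs0.
- exact: (int01_integrable (f := fun s => 'D_(0, v) F (s, x))).
apply: (int01_bound (f := fun s => F (s, v + x) - F (s, x) - 'D_(0, v) F (s, x))).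
  by apply: continuous_sub; [apply: continuous_sub; exact: cs0|exact: cs].
move=> s s01.
(* g interpolates along the segment from x to x + v; its increment over [0, 1]
   is the remainder. *)
pose g th := F (s, th *: v + x) - th * 'D_(0, v) F (s, x).
pose g' th := 'D_(0, v) F (s, th *: v + x) - 'D_(0, v) F (s, x).
have dg th : is_derive th (1 : R) g (g' th).
  apply: is_deriveB; last first.
    exact: is_derive_mulr.
  apply: (is_derive_curve (c := fun th => (s, th *: v + x)) (u := F)) => //.
  by apply: is_derive_pair; exact: is_derive_line.
have [th th01] : exists2 th, th \in `]0, 1[%R & g 1 - g 0 = g' th * (1 - 0).
  apply: MVT => //; apply: derivable_within_continuous => t _.
  exact: ex_derive.
rewrite subr0 mulr1 /g scale1r scale0r add0r mul1r mul0r subr0 => gE.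
rewrite (_ : _ - _ - _ = g' th); last by rewrite -gE; ring.
rewrite /g' !DF0 -sumrB (le_trans (ler_norm_sum _ _ _))//.
apply: (@le_trans _ _ (\sum_(i < m) k i * `|v| * (e / M))).
  apply: ler_sum => i _; rewrite -mulrBr normrM ler_pM//; first by case: (kP i).
  apply: dP => //.
  move: vd; rewrite -!ball_normE /= !sub0r !normrN normrZ; apply: le_lt_trans.
  move: th01; rewrite in_itv /= => /andP[t0 t1].
  by rewrite gtr0_norm// ler_piMl// ltW.
rewrite -!mulr_suml (_ : e * `|v| = M * `|v| * (e / M)); last first.
  by field; rewrite gt_eqF.
apply: ler_wpM2r; first by rewrite divr_ge0// ltW.
by apply: ler_wpM2r => //; rewrite /M lerDr.
Qed.

Lemma smooth_int01 V (F : R * V -> R) : coordinatized V -> smooth F ->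
  smooth (int01 F).
Proof.
move=> cV sF; apply/smooth_Ck => k.
elim: k F sF => [|k IH] F sF;
  (split; first by move=> x; case: (int01_diff x cV sF)) => // v.
have -> : 'D_v (int01 F) = int01 ('D_(0, v) F).
  by apply/funext => x; case: (int01_diff x cV sF).
exact/IH/smooth_derive.
Qed.

(** The integral of F over [0, t], brought back to a fixed segment by the
    substitution s -> s t so that smoothness in t and in x are obtained
    together. *)
Definition primitive V (F : R * V -> R) (p : R * V) : R :=
  p.1 * int01 (fun q => F (q.1 * q.2.1, q.2.2)) p.

Lemma smooth_scaled V (F : R * V -> R) : coordinatized V -> smooth F ->
  smooth (fun q : R * (R * V) => F (q.1 * q.2.1, q.2.2)).
Proof.
move=> cV sF; apply: (smooth_comp (g := F)) => //.
  by apply: coordinatized_prod => //; exact: coordinatized_R.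
have s1 := smooth_fst (@smooth_id R (R * (R * V))%type).
have s2 := smooth_snd (@smooth_id R (R * (R * V))%type).
by apply: smooth_pair; [apply: smoothM => //; exact: smooth_fst|exact: smooth_snd].
Qed.

Lemma smooth_primitive V (F : R * V -> R) : coordinatized V -> smooth F ->
  smooth (primitive F).
Proof.
move=> cV sF; apply: smoothM; first exact/smooth_fst/smooth_id.
apply: smooth_int01; last exact: smooth_scaled.
by apply: coordinatized_prod => //; exact: coordinatized_R.
Qed.

Lemma primitive0 V (F : R * V -> R) x : primitive F (0, x) = 0.
Proof. by rewrite /primitive mul0r. Qed.

Lemma derive_scaled V (F : R * V -> R) (q : R * (R * V)) (v : R * V) :
  'D_((0 : R), v) (fun q : R * (R * V) => F (q.1 * q.2.1, q.2.2)) q =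
  'D_(q.1 * v.1, v.2) F (q.1 * q.2.1, q.2.2).
Proof.
rewrite derive_lineE [RHS]derive_lineE; apply: (congr1 (fun f : R -> R => 'D_1 f 0)).
apply/funext => r; congr (F _); case: q => s [t x]; case: v => a v.
congr pair; rewrite /=.
have -> : r *: (0 : R) = 0 by exact: mulr0.
have sE (b c : R) : b *: c = b * c by [].
by rewrite add0r !sE; ring.
Qed.

Lemma derive_primitive_mul V (F : R * V -> R) p v : coordinatized V -> smooth F ->
  'D_v (primitive F) p =
  p.1 * int01 (fun q => 'D_(q.1 * v.1, v.2) F (q.1 * q.2.1, q.2.2)) p +
  v.1 * int01 (fun q => F (q.1 * q.2.1, q.2.2)) p.
Proof.
move=> cV sF; have cRV : coordinatized (R * V)%type.
  by apply: coordinatized_prod => //; exact: coordinatized_R.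
have sS := smooth_scaled cV sF.
have [dJ DJ] := int01_diff p cRV sS.
rewrite /primitive (@derive_scale _ _ _ fst)//; last first.
  exact/smooth_diff/smooth_fst/smooth_id.
rewrite derive_fst DJ.
suff -> : int01 ('D_(0, v) (fun q : R * (R * V) => F (q.1 * q.2.1, q.2.2))) p =
  int01 (fun q => 'D_(q.1 * v.1, v.2) F (q.1 * q.2.1, q.2.2)) p by [].
by apply: eq_Rintegral => s _; rewrite derive_scaled.
Qed.

Lemma derive_primitive_param V (F : R * V -> R) p v : coordinatized V -> smooth F ->
  'D_(0, v) (primitive F) p = primitive ('D_(0, v) F) p.
Proof.
move=> cV sF; rewrite derive_primitive_mul//= mul0r addr0.
suff -> : int01 (fun q => 'D_(q.1 * 0, v) F (q.1 * q.2.1, q.2.2)) p =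
  int01 (fun q => 'D_((0 : R), v) F (q.1 * q.2.1, q.2.2)) p by [].
by apply: eq_Rintegral => s _; rewrite mulr0.
Qed.

(** Differentiating under the integral gives the integral over [0, 1] of F (s
    t, x) + s t F_t (s t, x), which is the s-derivative of s F (s t, x). *)
Lemma derive_primitive V (F : R * V -> R) (p : R * V) : coordinatized V -> smooth F ->
  'D_((1 : R), (0 : V)) (primitive F) p = F p.
Proof.
move=> cV sF; rewrite derive_primitive_mul//= mul1r.
have cRV : coordinatized (R * V)%type.
  by apply: coordinatized_prod => //; exact: coordinatized_R.
have dF q : differentiable F q by exact: smooth_diff.
have sS := smooth_scaled cV sF.
have sS' := smooth_derive ((0 : R), ((1 : R), (0 : V))) sS.
have c0 : continuous (fun s : R => F (s * p.1, p.2)).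
  exact: (continuous_slice (x := p) (fun q => smooth_diff q sS)).
have c1 : continuous (fun s : R => 'D_(s, 0) F (s * p.1, p.2)).
  have := continuous_slice (x := p) (fun q => smooth_diff q sS').
  by under eq_fun do rewrite derive_scaled /= mulr1.
rewrite /int01 /=; under [in X in _ * X]eq_Rintegral do rewrite mulr1.
rewrite -RintegralZl//; last first.
  exact: (int01_integrable (f := fun s : R => 'D_(s, 0) F (s * p.1, p.2))).
rewrite -RintegralD//; last 2 first.
- apply: (int01_integrable (f := fun s : R => p.1 * 'D_(s, 0) F (s * p.1, p.2))).
  by apply: (continuous_mul (f := fun=> p.1)) => //; exact: cst_continuous.
- exact: (int01_integrable (f := fun s : R => F (s * p.1, p.2))).
have D (s : R) : is_derive s (1 : R) (fun s : R => s * F (s * p.1, p.2))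
    (p.1 * 'D_(s, 0) F (s * p.1, p.2) + F (s * p.1, p.2)).
  have dc : is_derive s (1 : R) (fun s : R => F (s * p.1, p.2)) ('D_(p.1, 0) F (s * p.1, p.2)).
    apply: (is_derive_curve (c := fun s : R => (s * p.1, p.2)) (u := F)) => //.
    by apply: is_derive_pair; exact: is_derive_mulr.
  have hZ (r : R) : 'D_(r, 0) F (s * p.1, p.2) = r * 'D_((1 : R), (0 : V)) F (s * p.1, p.2).
    rewrite !deriveE// (_ : (r, 0) = r *: ((1 : R), (0 : V))) ?linearZ//.
    by congr pair; rewrite /= ?scaler0// [RHS]mulr1.
  have H := is_derive_mul (is_derive_id s (1 : R)) dc.
  rewrite (_ : p.1 * _ + _ = id s * 'D_(p.1, 0) F (s * p.1, p.2) + F (s * p.1, p.2) * 1) //.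
  by rewrite hZ [in RHS]hZ mulr1; congr (_ + _); rewrite mulrCA.
have C : continuous (fun s : R => p.1 * 'D_(s, 0) F (s * p.1, p.2) + F (s * p.1, p.2)).
  apply: continuous_add => //.
  by apply: (continuous_mul (f := fun=> p.1)) => //; exact: cst_continuous.
by rewrite (int01_FTC D C) mul1r mul0r subr0 mul1r -surjective_pairing.
Qed.

(** A smooth function is its value at time 0 plus the primitive of its time
    derivative, and parameter derivatives pass under the primitive; so the
    order of the two derivations is immaterial. This case of Schwarz's theorem
    is the one that flows need. *)
Lemma mixed_derivative V (f : R * V -> R) (p : R * V) (v : V) :
  coordinatized V -> smooth f ->
  'D_((1 : R), (0 : V)) ('D_((0 : R), v) f) p =
  'D_((0 : R), v) ('D_((1 : R), (0 : V)) f) p.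
Proof.
move=> cV sf; pose ft := 'D_((1 : R), (0 : V)) f.
have sft : smooth ft by exact: smooth_derive.
have sP : smooth (primitive ft) by exact: smooth_primitive.
have fE : f = (fun q => f (0, q.2) + primitive ft q).
  apply/funext => -[t x] /=.
  have d1 (s : R) : is_derive s (1 : R) (fun s => f (s, x)) (ft (s, x)).
    exact/is_derive_slice/smooth_diff.
  have d2 (s : R) : is_derive s (1 : R) (fun s => primitive ft (s, x)) (ft (s, x)).
    by have := is_derive_slice (smooth_diff (s, x) sP); rewrite (derive_primitive _ cV sft).
  have := eq_derive_cst t 0 d1 d2; rewrite primitive0 subr0 => <-.
  by rewrite addrC subrK.
have sf0 : smooth (fun q : R * V => f (0, q.2)).
  apply: (smooth_comp (f := fun q : R * V => (0 : R, q.2))) => //.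
    by apply: coordinatized_prod => //; exact: coordinatized_R.
  by apply: smooth_pair; [exact: smooth_cst|exact/smooth_snd/smooth_id].
pose G := 'D_((0 : R), v) ft.
have sG : smooth G by exact: smooth_derive.
have DfE q : 'D_((0 : R), v) f q = 'D_((0 : R), v) f (0, q.2) + primitive G q.
  rewrite [in LHS]fE deriveD; [|exact/diff_derivable/smooth_diff..].
  rewrite derive_primitive_param//; apply: (congr1 (fun a => a + _)).
  rewrite derive_lineE [RHS]derive_lineE; apply: (congr1 (fun f : R -> R => 'D_1 f 0)).
  apply/funext => r; apply: (congr1 f).
  by congr pair; rewrite /= addr0 [RHS]mulr0.
have sDf : smooth ('D_((0 : R), v) f) by exact: smooth_derive.
case: p => t x.
have h1 := is_derive_slice (smooth_diff (t, x) sDf).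
have h2 : is_derive t (1 : R) (fun s => 'D_((0 : R), v) f (s, x)) (G (t, x)).
  under eq_fun do rewrite DfE /=.
  rewrite -[X in is_derive _ _ _ X]add0r; apply: is_deriveD.
  have := is_derive_slice (smooth_diff (t, x) (smooth_primitive cV sG)).
  by rewrite (derive_primitive _ cV sG).
by rewrite -(@derive_val _ _ _ _ _ _ _ h1) (@derive_val _ _ _ _ _ _ _ h2).
Qed.

End Integral.

(** * Linear differential equations *)

Section LinearODE.
Context {R : realType}.

Lemma is_derive_comp_opp (f : R -> R) (s d : R) : is_derive (- s) (1 : R) f d ->
  is_derive s (1 : R) (fun s => f (- s)) (- d).
Proof.
move=> df.
have dn : is_derive s (1 : R) (fun s : R => - s) (- 1).
  by apply: is_deriveN; exact: is_derive_id.
have df1 : differentiable f (- s) by apply/derivable1_diffP; exact: ex_derive.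
have := is_derive_curve (u := f) (c := fun s => - s) df1 dn.
by rewrite deriveE// linearN -deriveE// derive_val.
Qed.

Lemma is_derive_sum_fun n (f : 'I_n -> R -> R) (s : R) (d : 'I_n -> R) :
  (forall i, is_derive s (1 : R) (f i) (d i)) ->
  is_derive s (1 : R) (fun s => \sum_(i < n) f i s) (\sum_(i < n) d i).
Proof.
move=> df; have := @is_derive_sum _ _ _ n f s 1 d df.
by rewrite (_ : (fun _ => _) = \sum_(i < n) f i)//; apply/funext => t; rewrite fct_sumE.
Qed.

Lemma continuous_sum n (f : 'I_n -> R -> R) :
  (forall i, continuous (f i)) -> continuous (fun s => \sum_(i < n) f i s).
Proof.
elim: n f => [|n IH] f cf.
  by under eq_fun do rewrite big_ord0; exact: cst_continuous.
by under eq_fun do rewrite big_ord_recl; apply: continuous_add => //; exact: IH.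
Qed.

Lemma mulr_le_sqr (a b N : R) : a * a <= N -> b * b <= N -> a * b <= N.
Proof. by move=> aN bN; have := sqr_ge0 (a - b); rewrite sqrrB !expr2; lra. Qed.

(** Gronwall's argument: the squared norm N satisfies N' <= 2 C N on [0, t],
    where C bounds the coefficients, so exp (- 2 C s) N (s) is nonincreasing;
    it is nonnegative and starts at 0. *)
Lemma linear_ode_zero_ge0 n (m : 'I_n -> 'I_n -> R -> R) (w : 'I_n -> R -> R) t :
  (forall i j, continuous (m i j)) ->
  (forall i s, is_derive s (1 : R) (w i) (\sum_(j < n) m i j s * w j s)) ->
  (forall i, w i 0 = 0) -> 0 < t -> forall i, w i t = 0.
Proof.
move=> cm dw w0 t0.
pose mu s := \sum_(i < n) \sum_(j < n) `|m i j s|.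
have cmu : continuous mu.
  apply: continuous_sum => i; apply: continuous_sum => j s.
  apply: (continuous_comp (cm i j s)); exact: norm_continuous.
have [c c01 cmax] : exists2 c, c \in `[0, t]%R & forall s, s \in `[0, t]%R -> mu s <= mu c.
  by apply: EVT_max; [exact: ltW|exact: continuous_subspaceT].
pose C := mu c.
pose N s := \sum_(i < n) w i s * w i s.
have wN i s : w i s * w i s <= N s.
  rewrite /N (bigD1 i)//= lerDl sumr_ge0// => j _; by rewrite -expr2 sqr_ge0.
have N0 s : 0 <= N s by apply: sumr_ge0 => j _; rewrite -expr2 sqr_ge0.
pose N' s := \sum_(i < n) 2 * (w i s * \sum_(j < n) m i j s * w j s).
have dN s : is_derive s (1 : R) N (N' s).
  apply: is_derive_sum_fun => i; rewrite mulr_natl mulr2n.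
  exact: is_derive_mul.
have N'le s : s \in `[0, t]%R -> N' s <= 2 * C * N s.
  move=> s01; rewrite /N' -mulr_sumr -mulrA ler_pM2l//.
  apply: (@le_trans _ _ (mu s * N s)); last by rewrite ler_wpM2r// cmax.
  rewrite /mu mulr_suml; apply: ler_sum => i _.
  rewrite mulr_sumr mulr_suml; apply: ler_sum => j _.
  rewrite mulrCA (le_trans (ler_norm _))// normrM ler_wpM2l// normrM.
  by apply: mulr_le_sqr; rewrite -normrM ger0_norm// -expr2 sqr_ge0.
pose E s := expR ((- (2 * C)) * s) * N s.
pose E' s := expR ((- (2 * C)) * s) * (N' s - 2 * C * N s).
have dE s : is_derive s (1 : R) E (E' s).
  have de : is_derive s (1 : R) (fun s => expR ((- (2 * C)) * s))
      (expR ((- (2 * C)) * s) * (- (2 * C))).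
    apply: (@is_derive1_comp _ expR (fun s => - (2 * C) * s)).
    by under eq_fun do rewrite mulrC; exact: is_derive_mulr.
  by apply: (is_derive_eq (is_derive_mul de (dN s))); rewrite /E'; ring.
have Et : E t <= E 0.
  have [z z0t zE] : exists2 z, z \in `]0, t[%R & E t - E 0 = E' z * (t - 0).
    apply: MVT => //; apply: derivable_within_continuous => s _; exact: ex_derive.
  rewrite -subr_le0 zE subr0 pmulr_lle0// /E' pmulr_rle0 ?expR_gt0// subr_le0.
  by apply: N'le; apply: subset_itv_oo_cc.
have Nt : N t = 0.
  apply/eqP; rewrite eq_le N0 andbT.
  move: Et; rewrite /E mulr0 expR0 mul1r {2}/N big1 => [|i _]; last by rewrite w0 mul0r.
  by rewrite pmulr_rle0// expR_gt0.
move=> i; have := wN i t; rewrite Nt -expr2 => h.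
by apply/eqP; rewrite -sqrf_eq0 eq_le h sqr_ge0.
Qed.

Lemma linear_ode_zero n (m : 'I_n -> 'I_n -> R -> R) (w : 'I_n -> R -> R) t :
  (forall i j, continuous (m i j)) ->
  (forall i s, is_derive s (1 : R) (w i) (\sum_(j < n) m i j s * w j s)) ->
  (forall i, w i 0 = 0) -> forall i, w i t = 0.
Proof.
move=> cm dw w0 i; have [t0|t0|<-] := ltgtP 0 t; last exact: w0.
  exact: (linear_ode_zero_ge0 cm dw).
pose w' i s := w i (- s).
have := @linear_ode_zero_ge0 n (fun i j s => - m i j (- s)) w' (- t).
rewrite /w' opprK oppr0; apply => //; last by rewrite oppr_gt0.
- move=> a b s; apply: continuousN.
  by apply: (@continuous_comp _ _ _ -%R (m a b)); [exact: opp_continuous|exact: cm].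
- move=> a s; apply: (is_derive_eq (is_derive_comp_opp (dw a (- s)))).
  by rewrite -sumrN; apply: eq_bigr => j _; rewrite mulNr.
Qed.

End LinearODE.

(** * Flows of commuting vector fields *)

Section Directional.
Context {R : realType}.
Implicit Types U V W : normedModType R.

Lemma derive_comp U V W (f : U -> V) (g : V -> W) x v :
  differentiable f x -> differentiable g (f x) ->
  'D_v (fun x => g (f x)) x = 'D_('D_v f x) g (f x).
Proof.
move=> df dg; rewrite !deriveE//; last exact: (@differentiable_comp _ _ _ _ f g).
by rewrite (@diff_comp _ _ _ _ f g).
Qed.

Lemma derive_dirD V W (f : V -> W) x u v : differentiable f x ->
  'D_(u + v) f x = 'D_u f x + 'D_v f x.
Proof. by move=> df; rewrite !deriveE// linearD. Qed.

Lemma derive_dirZ V W (f : V -> W) x a v : differentiable f x ->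
  'D_(a *: v) f x = a *: 'D_v f x.
Proof. by move=> df; rewrite !deriveE// linearZ. Qed.

Lemma derive_dir_split V W W' (f : V * W -> W') x (a : V) (b : W) :
  differentiable f x -> 'D_(a, b) f x = 'D_(a, 0) f x + 'D_(0, b) f x.
Proof.
move=> df; rewrite -derive_dirD//; congr (derive _ _ _).
by congr pair; rewrite /= ?addr0 ?add0r.
Qed.

Lemma derive_rV_sum n W (f : 'rV[R]_n -> W) x v : differentiable f x ->
  'D_v f x = \sum_(i < n) v 0 i *: 'D_(delta_mx 0 i) f x.
Proof.
move=> df; rewrite {1}[v]row_sum_delta deriveE// linear_sum.
by apply: eq_bigr => i _; rewrite linearZ -deriveE.
Qed.

Lemma derive_coord V m n (f : V -> 'M[R]_(m, n)) x v i j : differentiable f x ->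
  'D_v (fun x => f x i j) x = ('D_v f x) i j.
Proof.
move=> df; rewrite (derive_comp (g := @lcoord R m n i j))//; last first.
  exact: differentiable_coord.
rewrite deriveE ?diff_lin//; [exact: coord_continuous|exact: differentiable_coord].
Qed.

Lemma derive_pair U V W (f : U -> V) (g : U -> W) x v :
  differentiable f x -> differentiable g x ->
  'D_v (fun x => (f x, g x)) x = ('D_v f x, 'D_v g x).
Proof.
by move=> df dg; rewrite !deriveE ?diff_pair//; exact: differentiable_pair.
Qed.

End Directional.

Section Flows.
Context {R : realType} {n : nat}.
Notation Rn := 'rV[R]_n.
Implicit Types (X Z : Rn -> Rn) (phi : R -> Rn -> Rn) (p q : Rn -> R).

Definition commuting X Z := forall y, 'D_(X y) Z y = 'D_(Z y) X y.

(** A flow as a function on space-time, so that joint smoothness and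
    derivatives in mixed directions can be spoken of. *)
Definition joint phi (P : R * Rn) : Rn := phi P.1 P.2.

Lemma coordinatized_time : coordinatized (R * Rn)%type.
Proof. by apply: coordinatized_prod; [exact: coordinatized_R|exact: coordinatized_rV]. Qed.

Lemma flow_derive_time X phi P : is_flow X phi ->
  'D_((1 : R), (0 : Rn)) (joint phi) P = X (joint phi P).
Proof.
case: P => s y [sphi _ dphi].
have h := is_derive_slice (smooth_diff (s, y) sphi).
by rewrite -(@derive_val _ _ _ _ _ _ _ h) (@derive_val _ _ _ _ _ _ _ (dphi s y)).
Qed.

(** Along a trajectory of X, the vector D phi_s (Z y) satisfies the linear
    equation w' = DX w, by exchanging the time and space derivatives of the
    flow; the vector Z (phi_s y) satisfies the same equation because DZ X = DX
    Z. Both start at Z y, so they agree. For Z = X this is the invariance of a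
    field under its own flow; for another field it is the infinitesimal form
    of the commutation of the two flows. *)
Lemma flow_push X Z phi s y : smooth X -> smooth Z -> commuting X Z ->
  is_flow X phi -> 'D_((0 : R), Z y) (joint phi) (s, y) = Z (phi s y).
Proof.
move=> sX sZ XZ fphi; have [sphi phi0 dphi] := fphi.
have sh : smooth (joint phi) := sphi.
have dX z : differentiable X z by exact: smooth_diff.
have dZ z : differentiable Z z by exact: smooth_diff.
have dh P : differentiable (joint phi) P by exact: smooth_diff.
pose hi i P := joint phi P 0 i.
have shi i : smooth (hi i) by exact: smooth_coord.
pose Xi i z := X z 0 i.
have sXi i : smooth (Xi i) by exact: smooth_coord.
have dXi i z : differentiable (Xi i) z by exact: smooth_diff.
pose m i j s := 'D_(delta_mx 0 j) (Xi i) (phi s y).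
pose w i s := 'D_((0 : R), Z y) (hi i) (s, y) - Z (phi s y) 0 i.
suff w0 i : w i s = 0.
  apply/rowP => i; apply/eqP; rewrite -subr_eq0 -derive_coord//.
  exact/eqP/w0.
apply: (@linear_ode_zero _ n m w s).
- move=> j k; apply: (continuous_slice (F := fun P => 'D_(delta_mx 0 k) (Xi j) (joint phi P))).
  move=> P; apply: (@differentiable_comp _ _ _ _ (joint phi) ('D_(delta_mx 0 k) (Xi j))) => //.
  exact/smooth_diff/smooth_derive.
- move=> j t.
  have h1 := is_derive_slice (smooth_diff (t, y) (smooth_derive ((0 : R), Z y) (shi j))).
  have h2 : is_derive t (1 : R) (fun s => Z (phi s y) 0 j) ('D_(X (phi t y)) Z (phi t y) 0 j).
    rewrite -derive_coord//.
    apply: (is_derive_curve (u := fun z => Z z 0 j) (c := fun s => phi s y)).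
    exact/smooth_diff/smooth_coord.
  apply: (is_derive_eq (is_deriveB h1 h2)).
  rewrite mixed_derivative//; last exact: coordinatized_rV.
  rewrite (_ : 'D_((1 : R), (0 : Rn)) (hi j) = (fun P => Xi j (joint phi P))); last first.
    by apply/funext => P; rewrite derive_coord// (flow_derive_time P fphi).
  rewrite XZ (derive_comp (f := joint phi) (g := Xi j))// -derive_coord// -/(Xi j).
  have E v : 'D_v (Xi j) (phi t y) =
      \sum_(k < n) v 0 k *: 'D_(delta_mx 0 k) (Xi j) (phi t y).
    exact/derive_rV_sum/dXi.
  rewrite (E (Z (phi t y))) E -sumrB.
  apply: eq_bigr => k _; rewrite /w /m mulrBr -derive_coord//.
  by apply: (congr2 (fun a b => a - b)); exact: mulrC.
- move=> j; rewrite /w phi0 derive_lineE.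
  rewrite (_ : (fun _ => _) = (fun r : R => (r *: Z y + y) 0 j)); last first.
    apply/funext => r; rewrite /hi /joint /= addr0.
    by rewrite (_ : r *: 0 = 0) ?phi0//; exact: mulr0.
  rewrite derive_coord; last exact/derivable1_diffP/ex_derive/is_derive_line.
  by rewrite (@derive_val _ _ _ _ _ _ _ (is_derive_line y (Z y) 0)) subrr.
Qed.

End Flows.

(** * Solving the pair of transport equations *)

Section Transport.
Context {R : realType} {n : nat}.
Notation Rn := 'rV[R]_n.
Implicit Types (X Z : Rn -> Rn) (phi : R -> Rn -> Rn) (p q : Rn -> R).

(** Data are carried forward by reading them at the starting point of the
    trajectory, that is, along the flow backwards in time. *)
Definition backflow phi (P : R * Rn) : Rn := phi (- P.1) P.2.

Lemma smooth_backflow phi : smooth (joint phi) -> smooth (backflow phi).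
Proof.
move=> sphi; apply: (smooth_comp (f := fun P : R * Rn => (- P.1, P.2)) (g := joint phi)) => //.
  exact: coordinatized_time.
apply: smooth_pair; last exact/smooth_snd/smooth_id.
exact/smoothN/smooth_fst/smooth_id.
Qed.

Lemma derive_backflow phi (P : R * Rn) (a : R) (v : Rn) :
  'D_(a, v) (backflow phi) P = 'D_(- a, v) (joint phi) (- P.1, P.2).
Proof.
rewrite derive_lineE [RHS]derive_lineE.
apply: (congr1 (fun f : R -> Rn => 'D_1 f 0)); apply/funext => r.
by rewrite /backflow /joint /=; congr (phi _ _); rewrite opprD -scalerN.
Qed.

Lemma backflow_push X Z phi t y : smooth X -> smooth Z -> commuting X Z ->
  is_flow X phi -> 'D_((0 : R), Z y) (backflow phi) (t, y) = Z (backflow phi (t, y)).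
Proof. by move=> sX sZ XZ fphi; rewrite derive_backflow oppr0; exact: (flow_push _ _ sX). Qed.

(** The starting point at time 0 of the trajectory through (t, y) does not
    change along that trajectory. *)
Lemma backflow_invariant X phi t y : smooth X -> is_flow X phi ->
  'D_((1 : R), X y) (backflow phi) (t, y) = 0.
Proof.
move=> sX fphi; have [sphi _ _] := fphi; rewrite derive_backflow.
rewrite derive_dir_split; last exact: smooth_diff.
rewrite (flow_push (Z := X) _ _ sX)//=.
rewrite (_ : (-1, 0) = (-1 : R) *: ((1 : R), (0 : Rn))); last first.
  by congr pair; rewrite /= ?scaler0// [RHS]mulr1.
rewrite derive_dirZ; last exact: smooth_diff.
by rewrite (flow_derive_time _ fphi) scaleN1r addNr.
Qed.

Lemma backflow_derive_time X phi (y : Rn) t : is_flow X phi ->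
  is_derive t (1 : R) (fun t => backflow phi (t, y)) (- X (backflow phi (t, y))).
Proof.
move=> fphi; have [sphi _ _] := fphi.
have := is_derive_slice (smooth_diff (t, y) (smooth_backflow sphi)).
rewrite derive_backflow (_ : (-1, 0) = (-1 : R) *: ((1 : R), (0 : Rn))); last first.
  by congr pair; rewrite /= ?scaler0// [RHS]mulr1.
rewrite derive_dirZ; last exact: smooth_diff.
by rewrite (flow_derive_time _ fphi) scaleN1r.
Qed.

Lemma smooth_along phi p : smooth p -> smooth (joint phi) ->
  smooth (fun P => p (backflow phi P)).
Proof.
move=> sp sphi; apply: smooth_comp => //; first exact: coordinatized_rV.
exact: smooth_backflow.
Qed.

(** The t-derivative of the left-hand side is Z applied to p o phi_(-t), which
    is (Z p) o phi_(-t) by transport of Z, hence (X q) o phi_(-t) by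
    compatibility, and this is minus the t-derivative of q o phi_(-t). With Z
    = X and q = p this computes X applied to the Duhamel integral. *)
Lemma primitive_along X Z phi p q t y :
  smooth X -> smooth Z -> smooth p -> smooth q -> commuting X Z ->
  (forall y, 'D_(X y) q y = 'D_(Z y) p y) -> is_flow X phi ->
  'D_((0 : R), Z y) (primitive (fun P => p (backflow phi P))) (t, y) =
  q y - q (backflow phi (t, y)).
Proof.
move=> sX sZ sp sq XZ pq fphi; have [sphi phi0 _] := fphi.
have cV : coordinatized Rn by exact: coordinatized_rV.
have sP := smooth_along sp sphi.
pose G := 'D_((0 : R), Z y) (fun P => p (backflow phi P)).
have sG : smooth G by exact: smooth_derive.
have sback := smooth_backflow sphi.
have GE s : G (s, y) = 'D_(X (backflow phi (s, y))) q (backflow phi (s, y)).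
  rewrite /G (derive_comp (g := p)); [|exact: smooth_diff..].
  by rewrite (backflow_push _ _ sX sZ)// pq.
rewrite derive_primitive_param// -/G.
have d1 (s : R) : is_derive s (1 : R) (fun s => primitive G (s, y)) (G (s, y)).
  have := is_derive_slice (smooth_diff (s, y) (smooth_primitive cV sG)).
  by rewrite (derive_primitive _ cV sG).
have d2 (s : R) : is_derive s (1 : R) (fun s => - q (backflow phi (s, y))) (G (s, y)).
  rewrite GE -[X in is_derive _ _ _ X]opprK; apply: is_deriveN.
  apply: (is_derive_eq (is_derive_curve (u := q) (smooth_diff _ sq)
    (backflow_derive_time y s fphi))).
  by rewrite -scaleN1r derive_dirZ ?scaleN1r//; exact: smooth_diff.
have := eq_derive_cst t 0 d1 d2; rewrite primitive0 subr0 => ->.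
by rewrite /backflow /= oppr0 phi0; ring.
Qed.

(** Duhamel's formula for u_t + X u = p with initial value u0. *)
Definition transported phi u0 p (P : R * Rn) : R :=
  u0 (backflow phi P) + primitive (fun P => p (backflow phi P)) P.

Lemma smooth_transported phi u0 p : smooth (joint phi) -> smooth u0 -> smooth p ->
  smooth (transported phi u0 p).
Proof.
move=> sphi su0 sp; apply: smoothD; first exact: smooth_along.
by apply: smooth_primitive; [exact: coordinatized_rV|exact: smooth_along].
Qed.

Lemma derive_transported X phi u0 p t y :
  smooth X -> smooth u0 -> smooth p -> is_flow X phi ->
  'D_((1 : R), X y) (transported phi u0 p) (t, y) = p y.
Proof.
move=> sX su0 sp fphi; have [sphi _ _] := fphi.
have sP := smooth_along sp sphi.
have cV : coordinatized Rn by exact: coordinatized_rV.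
have sprim := smooth_primitive cV sP.
rewrite deriveD; last 2 first.
- exact/diff_derivable/smooth_diff/smooth_along.
- exact/diff_derivable/smooth_diff.
rewrite (derive_comp (g := u0)); last 2 first.
- exact/smooth_diff/smooth_backflow.
- exact: smooth_diff.
rewrite backflow_invariant// (_ : 'D_0 u0 _ = 0) ?add0r; last first.
  by rewrite deriveE ?linear0//; exact: smooth_diff.
rewrite derive_dir_split; last exact: smooth_diff.
rewrite derive_primitive// (primitive_along (q := p) t y sX sX)//.
by rewrite addrC subrK.
Qed.

Lemma transported0 X phi u0 p y : is_flow X phi -> transported phi u0 p (0, y) = u0 y.
Proof.
by move=> [_ phi0 _]; rewrite /transported primitive0 /backflow oppr0 phi0 addr0.
Qed.

(** The systems for h and for S are instances of this one, in which the
    derivatives are along the constant directions (1, 0) and (0, 1) completed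
    by X and by Z. *)
Definition solves X Z p q u0 (u : R * R * Rn -> R) : Prop :=
  [/\ smooth u,
      forall P, 'D_(((1 : R), (0 : R)), X P.2) u P = p P.2,
      forall P, 'D_(((0 : R), (1 : R)), Z P.2) u P = q P.2
    & forall y, u (0, 0, y) = u0 y].

Lemma coordinatized_time2 : coordinatized (R * R * Rn)%type.
Proof.
apply: coordinatized_prod; last exact: coordinatized_rV.
by apply: coordinatized_prod; exact: coordinatized_R.
Qed.

Lemma derive_forget_tau (W : normedModType R) (F : R * Rn -> W) (P v : R * R * Rn) :
  'D_v (fun P : R * R * Rn => F (P.1.1, P.2)) P = 'D_(v.1.1, v.2) F (P.1.1, P.2).
Proof.
rewrite derive_lineE [RHS]derive_lineE.
exact: (congr1 (fun f : R -> W => 'D_1 f 0)).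
Qed.

Lemma smooth_forget_tau (W : normedModType R) (F : R * Rn -> W) : smooth F ->
  smooth (fun P : R * R * Rn => F (P.1.1, P.2)).
Proof.
move=> sF; apply: (smooth_comp (f := fun P : R * R * Rn => (P.1.1, P.2))) => //.
  exact: coordinatized_time.
by apply: smooth_pair; [exact/smooth_fst/smooth_fst/smooth_id|exact/smooth_snd/smooth_id].
Qed.

(** First carry u0 and q along Z during the time tau, then carry the result
    and p along X during the time t. The equation along X is Duhamel's
    formula. The equation along Z holds since the backward flow of X
    transports Z, the defect being controlled by the compatibility X q = Z p.
    When u0 = 0, the tau-derivative of this solution is explicit, and it will
    decide the solvability of the relation that defines tau. *)
Lemma solves_exists X Z phi psi p q u0 :
  smooth X -> smooth Z -> smooth p -> smooth q -> smooth u0 ->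
  commuting X Z -> (forall y, 'D_(X y) q y = 'D_(Z y) p y) ->
  is_flow X phi -> is_flow Z psi ->
  exists2 u, solves X Z p q u0 u &
    (forall y, u0 y = 0) -> forall t tau y,
    'D_(((0 : R), (1 : R)), (0 : Rn)) u (t, tau, y) = q (psi (- tau) (phi (- t) y)).
Proof.
move=> sX sZ sp sq su0 XZ pq fphi fpsi.
have [sphi phi0 _] := fphi; have [spsi psi0 _] := fpsi.
pose v := transported psi u0 q.
have sv : smooth v by exact: smooth_transported.
pose Q := primitive (fun P => p (backflow phi P)).
have sQ : smooth Q.
  by apply: smooth_primitive; [exact: coordinatized_rV|exact: smooth_along].
pose g (P : R * R * Rn) := (P.1.2, backflow phi (P.1.1, P.2)).
have sback := smooth_backflow sphi.
have sg2 := smooth_forget_tau sback.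
have sg1 : smooth (fun P : R * R * Rn => P.1.2).
  exact/smooth_snd/smooth_fst/smooth_id.
have sg : smooth g by exact: smooth_pair.
have Dg (P w : R * R * Rn) : 'D_w g P = (w.1.2, 'D_(w.1.1, w.2) (backflow phi) (P.1.1, P.2)).
  rewrite derive_pair; [|exact: smooth_diff..].
  rewrite derive_forget_tau derive_lineE /=; congr (_, _).
  exact: (@derive_val _ _ _ _ _ _ _ (is_derive_line P.1.2 w.1.2 0)).
pose u P := v (g P) + Q (P.1.1, P.2).
have Du (P w : R * R * Rn) :
    'D_w u P = 'D_('D_w g P) v (g P) + 'D_(w.1.1, w.2) Q (P.1.1, P.2).
  have s1 : smooth (fun P => v (g P)).
    by apply: smooth_comp => //; exact: coordinatized_time.
  have s2 := smooth_forget_tau sQ.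
  rewrite /u deriveD; [|exact/diff_derivable/smooth_diff..].
  by rewrite derive_forget_tau (derive_comp (g := v)); [|exact: smooth_diff..].
exists u; last first.
  move=> u00 t tau y; rewrite Du Dg /=.
  have -> : 'D_((0 : R), (0 : Rn)) Q (t, y) = 0 by exact: derive0.
  have -> : 'D_((0 : R), (0 : Rn)) (backflow phi) (t, y) = 0 by exact: derive0.
  rewrite addr0 /v (_ : transported _ _ _ = primitive (fun P => q (backflow psi P))).
    by rewrite derive_primitive//; [exact: coordinatized_rV|exact: smooth_along].
  by apply/funext => P; rewrite /transported u00 add0r.
split.
- apply: smoothD; last exact: smooth_forget_tau.
  by apply: smooth_comp => //; exact: coordinatized_time.
- move=> [[t tau] y] /=; rewrite Du Dg /= backflow_invariant//.
  rewrite (_ : 'D_(0, 0) v _ = 0); last first.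
    by rewrite deriveE ?(linear0 ('d v _))//; exact: smooth_diff.
  rewrite add0r derive_dir_split; last exact: smooth_diff.
  rewrite derive_primitive; [|exact: coordinatized_rV|exact: smooth_along].
  by rewrite (primitive_along (q := p) t y sX sX)// addrC subrK.
- move=> [[t tau] y] /=; rewrite Du Dg /= (backflow_push t y sX sZ)//.
  rewrite (derive_transported (X := Z))//.
  by rewrite (primitive_along t y sX sZ sp sq)// addrC subrK.
- move=> y; rewrite /u /g /= /Q primitive0 addr0 /backflow /= oppr0 phi0.
  exact: transported0 fpsi.
Qed.

End Transport.

(** * Uniqueness and periodicity by characteristics *)

Section Characteristics.
Context {R : realType} {n : nat}.
Notation Rn := 'rV[R]_n.
Variables (X Z : Rn -> Rn) (p q u0 : Rn -> R).

Lemma solves_along u (P : R * R * Rn) (a b : R) : solves X Z p q u0 u ->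
  'D_((a, b), a *: X P.2 + b *: Z P.2) u P = a * p P.2 + b * q P.2.
Proof.
move=> [su e1 e2 _]; have du : differentiable u P by exact: smooth_diff.
have -> : (a, b, a *: X P.2 + b *: Z P.2) =
    a *: ((1 : R), (0 : R), X P.2) + b *: ((0 : R), (1 : R), Z P.2).
  congr ((_, _), _); rewrite /=.
    by rewrite [a *: 1]mulr1 [b *: 0]mulr0 addr0.
  by rewrite [a *: 0]mulr0 [b *: 1]mulr1 add0r.
by rewrite derive_dirD// !derive_dirZ// e1 e2.
Qed.

Lemma solves_curve u (t tau : R -> R) (y : R -> Rn) s t' tau' :
  solves X Z p q u0 u ->
  is_derive s (1 : R) t t' -> is_derive s (1 : R) tau tau' ->
  is_derive s (1 : R) y (t' *: X (y s) + tau' *: Z (y s)) ->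
  is_derive s (1 : R) (fun s => u (t s, tau s, y s)) (t' * p (y s) + tau' * q (y s)).
Proof.
move=> hu dt dtau dy; have [su _ _ _] := hu.
rewrite -(solves_along (t s, tau s, y s) t' tau' hu).
apply: (is_derive_curve (c := fun s => (t s, tau s, y s)) (u := u)).
  exact: smooth_diff.
by apply: is_derive_pair => //; exact: is_derive_pair.
Qed.

Lemma is_derive_subl (t s : R) : is_derive s (1 : R) (fun s => t - s) (- 1).
Proof.
rewrite -[X in is_derive _ _ _ X]add0r.
exact: is_deriveB.
Qed.

(** Going backwards along X from t to 0, then along Z from tau to 0, the two
    solutions change by the same amount and reach the same initial value. *)
Lemma solves_unique phi psi u u' : is_flow X phi -> is_flow Z psi ->
  solves X Z p q u0 u -> solves X Z p q u0 u' -> u' = u.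
Proof.
move=> fphi fpsi hu hu'; apply/funext => -[[t tau] y].
have [_ phi0 _] := fphi; have [_ psi0 _] := fpsi.
(* Each curve runs backwards in time from the given point, along a trajectory
   of X and then along one of Z. *)
have dX w (hw : solves X Z p q u0 w) s : is_derive s (1 : R)
    (fun s => w (t - s, tau, backflow phi (s, y))) (- p (backflow phi (s, y))).
  apply: (is_derive_eq (solves_curve hw (is_derive_subl t s) (is_derive_const tau s) _)).
    rewrite scaleN1r scale0r addr0; exact: backflow_derive_time.
  by rewrite mulN1r mul0r addr0.
have dZ w (hw : solves X Z p q u0 w) z s : is_derive s (1 : R)
    (fun s => w (0, tau - s, backflow psi (s, z))) (- q (backflow psi (s, z))).
  apply: (is_derive_eq (solves_curve hw (is_derive_const 0 s) (is_derive_subl tau s) _)).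
    rewrite scaleN1r scale0r add0r; exact: backflow_derive_time.
  by rewrite mulN1r mul0r add0r.
have [_ _ _ i] := hu; have [_ _ _ i'] := hu'.
have := eq_derive_cst 0 t (dX _ hu) (dX _ hu').
rewrite subrr subr0 /backflow /= oppr0 phi0.
set z := phi (- t) y.
have := eq_derive_cst 0 tau (dZ _ hu z) (dZ _ hu' z).
rewrite subrr subr0 /backflow /= oppr0 psi0 !i !i'.
move=> + +; lra.
Qed.

(** Follow the flow of Ge, adding the elapsed time to tau and the increment of
    its first component to t. Since the second component of Ge is g X + Z, the
    solution changes at the rate g p + q = 0; after one period the point and t
    are back, whereas tau has increased by the period. *)
Lemma solves_periodic (Ge : Rn -> R * Rn) Phi u (c : R) :
  (forall y, (Ge y).2 = (Ge y).1 *: X y + Z y) ->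
  (forall y, (Ge y).1 * p y + q y = 0) ->
  is_flow (augmented Ge) Phi -> (forall t P, Phi (t + c) P = Phi t P) ->
  solves X Z p q u0 u -> forall t tau y, u (t, tau + c, y) = u (t, tau, y).
Proof.
move=> GeE pq [_ Phi0 dPhi] per hu t tau y.
pose P s := Phi s (0, y).
have P0 : P 0 = (0, y) by exact: Phi0.
have Pc : P c = (0, y) by rewrite -P0 /P -(per 0) add0r.
have dP s : is_derive s (1 : R) P (Ge (P s).2) by exact: dPhi.
have d1 s : is_derive s (1 : R) (fun s => t + (P s).1) (Ge (P s).2).1.
  rewrite -[X in is_derive _ _ _ X]add0r; apply: is_deriveD.
  exact: is_derive_fst.
have d2 s : is_derive s (1 : R) (fun s => (P s).2) (Ge (P s).2).2.
  exact: is_derive_snd.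
have dtau s : is_derive s (1 : R) (fun s => tau + s) 1.
  rewrite -[X in is_derive _ _ _ X]add0r; apply: is_deriveD.
have d s : is_derive s (1 : R) (fun s => u (t + (P s).1, tau + s, (P s).2)) 0.
  apply: (is_derive_eq (solves_curve hu (d1 s) (dtau s) _)).
    by rewrite scale1r -GeE.
  by rewrite mul1r pq.
have := @is_derive_0_is_cst _ _ c 0 d.
by rewrite Pc P0 /= !addr0.
Qed.

End Characteristics.

(** * A global implicit function theorem *)

Section Implicit.
Context {R : realType} {V : normedModType R}.
Variables (u : V * R -> R) (tau : V -> R).
Hypothesis cV : coordinatized V.
Hypothesis su : smooth u.
Hypothesis u_tau : forall x s, u (x, s) = 0 <-> s = tau x.
Hypothesis du_gt0 : forall P, 0 < 'D_((0 : V), (1 : R)) u P.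

Lemma is_derive_slice_last (x : V) (s : R) :
  is_derive s (1 : R) (fun s => u (x, s)) ('D_((0 : V), (1 : R)) u (x, s)).
Proof.
apply: (is_derive_curve (c := fun s : R => (x, s)) (u := u)); first exact: smooth_diff.
by apply: is_derive_pair.
Qed.

Lemma slice_increasing x (a b : R) : a < b -> u (x, a) < u (x, b).
Proof.
move=> ab.
have [z _ zE] : exists2 z, z \in `]a, b[%R &
    u (x, b) - u (x, a) = 'D_((0 : V), (1 : R)) u (x, z) * (b - a).
  apply: (@MVT _ (fun s => u (x, s)) (fun z => 'D_((0 : V), (1 : R)) u (x, z))) => //.
    by move=> s _; exact: is_derive_slice_last.
  apply: derivable_within_continuous => s _.
  exact: (@ex_derive _ _ _ _ _ _ _ (is_derive_slice_last x s)).
by rewrite -subr_gt0 zE mulr_gt0// subr_gt0.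
Qed.

Lemma implicit_root x : u (x, tau x) = 0.
Proof. exact/u_tau. Qed.

(** u (x0, .) is negative just below tau x0 and positive just above; the signs
    persist for x near x0, and monotonicity locates tau x between the two
    abscissas. *)
Lemma implicit_continuous : continuous tau.
Proof.
move=> x0; apply/cvgrPdist_lt => e e0.
have cu s : (fun x => u (x, s)) @ x0 --> u (x0, s).
  apply: (@differentiable_continuous _ _ _ x0 (fun x => u (x, s))).
  apply: (@differentiable_comp _ _ _ _ (fun x => (x, s)) u); last exact: smooth_diff.
  exact: differentiable_pair.
have lo : u (x0, tau x0 - e) < 0 by rewrite -(implicit_root x0) slice_increasing// ltrBlDr ltrDl.
have hi : 0 < u (x0, tau x0 + e) by rewrite -(implicit_root x0) slice_increasing// ltrDl.
near=> x.
have lox : u (x, tau x0 - e) < 0.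
  by near: x; exact: (cvgr_lt _ (cu _)).
have hix : 0 < u (x, tau x0 + e).
  by near: x; exact: (cvgr_gt _ (cu _)).
have h1 : tau x0 - e < tau x.
  rewrite ltNge; apply/negP; rewrite le_eqVlt => /predU1P[xE|/(slice_increasing x)].
    by move: lox; rewrite -xE implicit_root ltxx.
  by rewrite implicit_root => /lt_trans /(_ lox); rewrite ltxx.
have h2 : tau x < tau x0 + e.
  rewrite ltNge; apply/negP; rewrite le_eqVlt => /predU1P[xE|/(slice_increasing x)].
    by move: hix; rewrite xE implicit_root ltxx.
  by rewrite implicit_root => /(lt_trans hix); rewrite ltxx.
by rewrite ltr_norml; apply/andP; split; lra.
Unshelve. all: by end_near. Qed.

(** The first order expansion of u at the root vanishes up to o(|v| + |k|),
    where k is the increment of tau. A first use with a crude constant gives k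
    = O(|v|), a second one the derivative. *)
Lemma implicit_diff x : differentiable tau x /\
  forall v, 'D_v tau x =
    - ('D_((0 : V), (1 : R)) u (x, tau x))^-1 * 'D_(v, (0 : R)) u (x, tau x).
Proof.
pose P0 : V * R := (x, tau x); pose c := 'D_((0 : V), (1 : R)) u P0.
have c0 : 0 < c by exact: du_gt0.
have du : differentiable u P0 by exact: smooth_diff.
pose L v : R := - c^-1 * 'D_(v, (0 : R)) u P0.
have linL : linear L.
  move=> a v w; rewrite /L.
  have -> : (a *: v + w, 0) = a *: (v, (0 : R)) + (w, (0 : R)).
    by congr pair; rewrite /= ?addr0 [RHS]mulr0.
  rewrite derive_dirD// derive_dirZ// mulrDr; congr (_ + _).
  exact: mulrCA.
pose LM := GRing.isLinear.Build _ _ _ _ _ linL.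
pose LL : {linear V -> R} := HB.pack L LM.
have cL : continuous LL.
  have -> : (LL : V -> R) = (fun v => - c^-1 *: 'd u P0 (v, (0 : R))).
    by apply/funext => v; rewrite -deriveE.
  move=> v; apply/differentiable_continuous/differentiableZ.
  apply: (@differentiable_comp _ _ _ _ (fun v => (v, 0 : R)) ('d u P0)).
    exact: differentiable_pair.
  exact/linear_differentiable/diff_continuous.
have [M M0 MP] := linear_lipschitz cL.
suff [dt dE] : differentiable tau x /\ 'd tau x = LL :> (V -> R).
  by split=> // v; rewrite deriveE// dE.
apply: differentiable_bound => // e e0.
pose C := 2 * (M + 1).
(* c / 2 suffices for the crude estimate of k; the second bound is what the
   final estimate asks for. *)
pose e1 := Num.min (c / 2) (e * c / (1 + C)).
have C0 : 0 < C by rewrite /C mulr_gt0// addr_gt0.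
have e10 : 0 < e1.
  by rewrite lt_min divr_gt0//= divr_gt0// ?mulr_gt0// addr_gt0.
have ub : \forall w \near (0 : V * R), `|u (w + P0) - u P0 - 'd u P0 w| <= e1 * `|w|.
  have /eqaddoP/(_ e1 e10) := diff_locally du.
  by apply: filterS => w; rewrite /= opprD addrA.
have ct : (fun v => (v, tau (v + x) - tau x)) @ (0 : V) --> (0 : V * R).
  have tx : tau (v + x) - tau x @[v --> (0 : V)] --> (0 : R).
    rewrite -(subrr (tau x)); apply: cvgB; last exact: cvg_cst.
    rewrite -{2}[x]add0r.
    apply: (@continuous_comp _ _ _ (fun v => v + x) tau); last exact: implicit_continuous.
    by apply: cvgD; [exact: cvg_id|exact: cvg_cst].
  exact: (cvg_pair (F := nbhs (0 : V)) (f := id) cvg_id tx).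
have ubv : \forall v \near (0 : V),
    `|u ((v, tau (v + x) - tau x) + P0) - u P0 - 'd u P0 (v, tau (v + x) - tau x)|
      <= e1 * `|(v, tau (v + x) - tau x)|.
  exact: ct _ ub.
apply: filterS ubv => v /=.
set k := tau (v + x) - tau x; rewrite /P0 /=.
have -> : (v, k) + (x, tau x) = (v + x, tau (v + x)).
  by congr pair; rewrite /= /k subrK.
rewrite !implicit_root subrr sub0r normrN -(deriveE _ du) derive_dir_split//.
rewrite -/P0 (_ : (0, k) = k *: ((0 : V), (1 : R))); last first.
  by congr pair; rewrite /= ?scaler0// [RHS]mulr1.
rewrite derive_dirZ// -/c.
have -> : 'D_(v, 0) u P0 = - c * LL v.
  by rewrite /LL /= /L mulrA mulrNN divff ?gt_eqF// mul1r.
have -> : - c * LL v + k *: c = c * (k - LL v).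
  by rewrite mulrBr [c * k]mulrC mulNr addrC.
rewrite normrM (gtr0_norm c0) => kP.
have nP : `|(v, k)| <= `|v| + `|k|.
  by rewrite /Num.norm/= ge_max lerDl lerDr !normr_ge0.
have e1c : e1 <= c / 2 by rewrite ge_min lexx.
have e1e : e1 <= e * c / (1 + C) by rewrite ge_min lexx orbT.
have nk := normr_ge0 k; have nv := normr_ge0 v.
have kL : `|k| <= C * `|v|.
  have h1 : `|k - LL v| <= (`|v| + `|k|) / 2.
    rewrite -(ler_pM2l c0) (_ : c * ((`|v| + `|k|) / 2) =
        c / 2 * (`|v| + `|k|)); last by rewrite mulrAC mulrA.
    by apply: (le_trans kP); apply: ler_pM => //; exact: ltW.
  have h2 : `|k| <= `|k - LL v| + `|LL v|.
    by rewrite -{1}(subrK (LL v) k) ler_normD.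
  have h3 := MP v; rewrite /C; lra.
rewrite -(ler_pM2l c0); apply: (le_trans kP).
apply: (@le_trans _ _ (e * c / (1 + C) * ((1 + C) * `|v|))).
  apply: ler_pM => //; first exact: ltW.
  by apply: (le_trans nP); lra.
rewrite mulrA divfK ?gt_eqF ?addr_gt0//.
by rewrite mulrA [c * e]mulrC.
Qed.

(** The derivative of tau is a smooth function of (x, tau x), hence has as
    many derivatives as tau. *)
Lemma implicit_smooth : smooth tau.
Proof.
apply/smooth_Ck; elim=> [|k IH];
  (split; first by move=> x; case: (implicit_diff x)) => // v.
pose H (P : V * R) := (- ('D_((0 : V), (1 : R)) u P)^-1) * 'D_(v, (0 : R)) u P.
have sH : smooth H.
  apply: smoothM; last exact: smooth_derive.
  by apply/smoothN/smoothV; [move=> P; rewrite gt_eqF|exact: smooth_derive].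
have -> : 'D_v tau = (fun x => H (x, tau x)).
  by apply/funext => x; case: (implicit_diff x).
apply: (Ck_comp (f := fun x => (x, tau x)) (g := H)).
- by apply: coordinatized_prod => //; exact: coordinatized_R.
- by apply: Ck_pair => //; exact: ((smooth_Ck _).1 (@smooth_id _ _) k).
- exact: ((smooth_Ck _).1 sH k).
Qed.

End Implicit.

(** * Commutation of the reduced fields *)

Section Fields.
Context {R : realType} {n : nat}.
Notation Rn := 'rV[R]_n.
Variables (Ge Ke : Rn -> R * Rn).
Hypothesis sGe : smooth Ge.
Hypothesis sKe : smooth Ke.
Hypothesis a0 : forall y, (Ke y).1 != 0.
Hypothesis GK : forall Y, lie_bracket (augmented Ge) (augmented Ke) Y = 0.

Let a y := (Ke y).1.
Let A y := (Ke y).2.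
Let g y := (Ge y).1.
Let B y := (Ge y).2.
Let X := t_field Ke.
Let Z := tau_field Ge Ke.
(** The right-hand sides of the system for S after division by the first
    component of Ke. *)
Definition S_rhs_t y := (a y)^-1.
Definition S_rhs_tau y := - (g y / a y).

Let sa : smooth a. Proof. exact: smooth_fst. Qed.
Let sA : smooth A. Proof. exact: smooth_snd. Qed.
Let sg : smooth g. Proof. exact: smooth_fst. Qed.
Let sB : smooth B. Proof. exact: smooth_snd. Qed.

Lemma smooth_S_rhs_t : smooth S_rhs_t.
Proof. exact: smoothV. Qed.

Lemma smooth_S_rhs_tau : smooth S_rhs_tau.
Proof. by apply: smoothN; apply: smoothM => //; exact: smoothV. Qed.

Lemma smooth_t_field : smooth X.
Proof. by apply: smoothZ => //; exact: smoothV. Qed.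

Lemma smooth_tau_field : smooth Z.
Proof.
apply: smoothB => //; apply: smoothZ => //.
by apply: smoothM => //; exact: smoothV.
Qed.

(** The fields do not depend on t, so only the y-components enter their
    bracket. *)
Lemma bracket_eq y : 'D_(A y) Ge y = 'D_(B y) Ke y.
Proof.
have := GK (0, y); rewrite /lie_bracket /=.
have s2 : smooth (fun Y : R * Rn => Y.2) by exact/smooth_snd/smooth_id.
have E (F : Rn -> R * Rn) (v : R * Rn) : smooth F ->
    'd (augmented F) (0, y) v = 'D_(v.2) F y.
  move=> sF; rewrite -deriveE; last first.
    apply: smooth_diff; apply: smooth_comp => //; exact: coordinatized_rV.
  rewrite (derive_comp (f := fun Y : R * Rn => Y.2) (g := F)); [|exact: smooth_diff..].
  by rewrite derive_snd.
move=> /subr0_eq h; rewrite -(E Ge (Ke y) sGe) -(E Ke (Ge y) sKe); exact: h.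
Qed.

Lemma derive_fst_comp (F : Rn -> R * Rn) y v : smooth F ->
  'D_v (fun y => (F y).1) y = ('D_v F y).1.
Proof.
move=> sF; rewrite (derive_comp (f := F) (g := fst)) ?derive_fst//; first exact: smooth_diff.
exact/smooth_diff/smooth_fst/smooth_id.
Qed.

Lemma derive_snd_comp (F : Rn -> R * Rn) y v : smooth F ->
  'D_v (fun y => (F y).2) y = ('D_v F y).2.
Proof.
move=> sF; rewrite (derive_comp (f := F) (g := snd)) ?derive_snd//; first exact: smooth_diff.
exact/smooth_diff/smooth_snd/smooth_id.
Qed.

Let da y : differentiable a y. Proof. exact: smooth_diff. Qed.
Let dA y : differentiable A y. Proof. exact: smooth_diff. Qed.
Let dg y : differentiable g y. Proof. exact: smooth_diff. Qed.
Let dB y : differentiable B y. Proof. exact: smooth_diff. Qed.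

Let bracket_scalar y : 'D_(A y) g y = 'D_(B y) a y.
Proof.
transitivity ('D_(A y) Ge y).1; first exact: derive_fst_comp.
by rewrite bracket_eq; exact/esym/derive_fst_comp.
Qed.

Let bracket_vector y : 'D_(A y) B y = 'D_(B y) A y.
Proof.
transitivity ('D_(A y) Ge y).2; first exact: derive_snd_comp.
by rewrite bracket_eq; exact/esym/derive_snd_comp.
Qed.

Let differentiable_inv y : differentiable (fun y => (a y)^-1) y.
Proof. by apply: differentiableV => //; exact: a0. Qed.

Let derive_inv y v : 'D_v (fun y => (a y)^-1) y = - ((a y)^-1 * (a y)^-1) * 'D_v a y.
Proof.
rewrite deriveV; [|exact: a0|exact: diff_derivable].
by rewrite -invfM -expr2.
Qed.

Let derive_ratio y v : 'D_v (fun y => g y / a y) y =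
  'D_v g y / a y - g y * ((a y)^-1 * (a y)^-1) * 'D_v a y.
Proof.
rewrite (derive_scale (f := g) (g := fun y => (a y)^-1)); [|exact: dg|exact: differentiable_inv].
by rewrite derive_inv -![_ *: _]/(_ * _); ring.
Qed.

Let derive_X y v : 'D_v X y = (a y)^-1 *: 'D_v A y - ((a y)^-1 * (a y)^-1 * 'D_v a y) *: A y.
Proof.
rewrite (derive_scale (f := fun y => (a y)^-1) (g := A));
  [|exact: differentiable_inv|exact: dA].
by rewrite derive_inv mulNr scaleNr.
Qed.

Let derive_Z y v : 'D_v Z y = 'D_v B y - ((g y / a y) *: 'D_v A y +
  ('D_v g y / a y - g y * ((a y)^-1 * (a y)^-1) * 'D_v a y) *: A y).
Proof.
have dq : differentiable (fun y => g y / a y) y.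
  by apply: (differentiable_scale (f := g)); [exact: dg|exact: differentiable_inv].
rewrite deriveB; last 2 first.
- exact/diff_derivable/dB.
- apply/diff_derivable/(differentiable_scale (f := fun y => g y / a y)) => //; exact: dA.
rewrite (derive_scale (f := fun y => g y / a y) (g := A)) ?derive_ratio//; exact: dA.
Qed.

Let dir_X (W : normedModType R) (F : Rn -> W) y : differentiable F y ->
  'D_(X y) F y = (a y)^-1 *: 'D_(A y) F y.
Proof. by move=> dF; rewrite derive_dirZ. Qed.

Let dir_Z (W : normedModType R) (F : Rn -> W) y : differentiable F y ->
  'D_(Z y) F y = 'D_(B y) F y - (g y / a y) *: 'D_(A y) F y.
Proof. by move=> dF; rewrite derive_dirD// -scaleNr derive_dirZ// scaleNr. Qed.

(** With K = (a, A) and G = (g, B) one has X = A / a and Z = B - g X, that is,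
    Z is G corrected by a multiple of K so as not to move t. Expanding the
    bracket, everything cancels once D_A g = D_B a and D_A B = D_B A. *)
Lemma commuting_fields : commuting X Z.
Proof.
move=> y; rewrite dir_X ?dir_Z; last 2 first.
- exact/smooth_diff/smooth_t_field.
- exact/smooth_diff/smooth_tau_field.
rewrite !derive_X !derive_Z bracket_vector bracket_scalar.
apply/rowP => i; rewrite !mxE; have := a0 y; rewrite -/(a y).
move: (a y) (g y) (A y 0 i) ('D_(B y) a y) ('D_(A y) a y) => a' g' A' x1 x2.
move: ('D_(B y) A y) ('D_(A y) A y) => x3 x4 a'0.
by field.
Qed.

(** The integrability condition of the system for S, from the same two
    identities. *)
Lemma S_rhs_compatible y : 'D_(X y) S_rhs_tau y = 'D_(Z y) S_rhs_t y.
Proof.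
rewrite dir_X ?dir_Z; last 2 first.
- exact/smooth_diff/smooth_S_rhs_t.
- exact/smooth_diff/smooth_S_rhs_tau.
rewrite !derive_inv deriveN; last first.
  apply/diff_derivable/(differentiable_scale (f := g)); [exact: dg|exact: differentiable_inv].
rewrite derive_ratio bracket_scalar; have := a0 y; rewrite -/(a y).
move: (a y) (g y) ('D_(B y) a y) ('D_(A y) a y) => a' g' x1 x2 a'0.
by rewrite -![_ *: _]/(_ * _); field.
Qed.

Lemma Ge2E y : (Ge y).2 = (Ge y).1 *: X y + Z y.
Proof.
by rewrite /X /Z /t_field /tau_field scalerA addrC subrK.
Qed.

End Fields.

(** * The two systems as directional derivatives *)

Section Translation.
Context {R : realType} {n : nat}.
Notation Rn := 'rV[R]_n.
Variables (Ge Ke : Rn -> R * Rn).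
Hypothesis a0 : forall y, (Ke y).1 != 0.

Definition curry3 (u : R * R * Rn -> R) t tau y := u (t, tau, y).
Definition uncurry3 (u : R -> R -> Rn -> R) (P : R * R * Rn) := u P.1.1 P.1.2 P.2.

Lemma curry3K u : uncurry3 (curry3 u) = u.
Proof. by apply/funext => -[[t tau] y]. Qed.

Lemma uncurry3_inj u u' : uncurry3 u = uncurry3 u' -> u = u'.
Proof.
move=> e; apply/funext => t; apply/funext => tau; apply/funext => y.
exact: (congr1 (fun f => f (t, tau, y)) e).
Qed.

Lemma dotp_grad (u : Rn -> R) (v y : Rn) : differentiable u y ->
  dotp v (grad u y) = 'D_v u y.
Proof.
move=> du; rewrite derive_rV_sum//; apply: eq_bigr => i _.
by rewrite /grad mxE.
Qed.

Lemma dotp_grad_uncurry3 u t tau (v y : Rn) : smooth (uncurry3 u) ->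
  dotp v (grad (u t tau) y) = 'D_(((0 : R), (0 : R)), v) (uncurry3 u) (t, tau, y).
Proof.
move=> su; have du : differentiable (uncurry3 u) (t, tau, y) by exact: smooth_diff.
rewrite dotp_grad; last first.
  apply: (@differentiable_comp _ _ _ _ (fun y => (t, tau, y)) (uncurry3 u)) => //.
rewrite derive_lineE [RHS]derive_lineE.
apply: (congr1 (fun f : R -> R => 'D_1 f 0)); apply/funext => r.
rewrite /uncurry3 /=.
have E (b : R) : r *: (0 : R) + b = b by rewrite [r *: 0]mulr0 add0r.
by rewrite !E.
Qed.

Lemma derive1_uncurry3_t u t tau (y : Rn) : smooth (uncurry3 u) ->
  derive1 (fun s => u s tau y) t = 'D_(((1 : R), (0 : R)), (0 : Rn)) (uncurry3 u) (t, tau, y).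
Proof.
move=> su; have du : differentiable (uncurry3 u) (t, tau, y) by exact: smooth_diff.
rewrite derive1E.
have h : is_derive t (1 : R) (fun s : R => (s, tau, y)) (((1 : R), (0 : R)), (0 : Rn)).
  by apply: is_derive_pair; apply: is_derive_pair.
exact: (@derive_val _ _ _ _ _ _ _ (is_derive_curve du h)).
Qed.

Lemma derive1_uncurry3_tau u t tau (y : Rn) : smooth (uncurry3 u) ->
  derive1 (fun s => u t s y) tau = 'D_(((0 : R), (1 : R)), (0 : Rn)) (uncurry3 u) (t, tau, y).
Proof.
move=> su; have du : differentiable (uncurry3 u) (t, tau, y) by exact: smooth_diff.
rewrite derive1E.
have h : is_derive tau (1 : R) (fun s : R => (t, s, y)) (((0 : R), (1 : R)), (0 : Rn)).
  by apply: is_derive_pair; apply: is_derive_pair.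
exact: (@derive_val _ _ _ _ _ _ _ (is_derive_curve du h)).
Qed.

Let dirE (u : R * R * Rn -> R) P (a s t : R) (v w : Rn) :
  differentiable u P -> w = a *: v ->
  a * 'D_((s, t), (0 : Rn)) u P + 'D_(((0 : R), (0 : R)), w) u P =
  a * 'D_((s, t), v) u P.
Proof.
move=> du ->; rewrite [X in _ = _ * X]derive_dir_split// mulrDr; congr (_ + _).
rewrite (_ : ((0, 0), a *: v) = a *: (((0 : R), (0 : R)), v)) ?derive_dirZ//.
by congr ((_, _), _); rewrite /= [RHS]mulr0.
Qed.

Lemma system_t u t tau (y : Rn) : smooth (uncurry3 u) ->
  (Ke y).1 * derive1 (fun s => u s tau y) t + dotp (Ke y).2 (grad (u t tau) y) =
  (Ke y).1 * 'D_(((1 : R), (0 : R)), t_field Ke y) (uncurry3 u) (t, tau, y).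
Proof.
move=> su; rewrite (dotp_grad_uncurry3 t tau _ y su) (derive1_uncurry3_t t tau y su).
apply: dirE; first exact: smooth_diff.
by rewrite /t_field scalerA divff// scale1r.
Qed.

Lemma system_tau u t tau (y : Rn) : smooth (uncurry3 u) ->
  (Ke y).1 * derive1 (fun s => u t s y) tau +
    dotp ((Ke y).1 *: (Ge y).2 - (Ge y).1 *: (Ke y).2) (grad (u t tau) y) =
  (Ke y).1 * 'D_(((0 : R), (1 : R)), tau_field Ge Ke y) (uncurry3 u) (t, tau, y).
Proof.
move=> su; rewrite (dotp_grad_uncurry3 t tau _ y su) (derive1_uncurry3_tau t tau y su).
apply: dirE; first exact: smooth_diff.
by rewrite /tau_field scalerBr scalerA mulrC divfK.
Qed.

Lemma solves_hP f0 h : solves_h_system Ge Ke f0 h <->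
  solves (t_field Ke) (tau_field Ge Ke) (fun=> 0) (fun=> 0) f0 (uncurry3 h).
Proof.
split=> -[su e1 e2 i]; split => //.
- move=> [[t tau] y]; apply: (mulfI (a0 y)).
  by rewrite mulr0 -system_t.
- move=> [[t tau] y]; apply: (mulfI (a0 y)).
  by rewrite mulr0 -system_tau.
- by move=> t tau y; rewrite system_t// (e1 (t, tau, y)) mulr0.
- by move=> t tau y; rewrite system_tau// (e2 (t, tau, y)) mulr0.
Qed.

Lemma solves_SP S : solves_S_system Ge Ke S <->
  solves (t_field Ke) (tau_field Ge Ke) (S_rhs_t Ke) (S_rhs_tau Ge Ke) (fun=> 0) (uncurry3 S).
Proof.
have E y : (Ke y).1 * S_rhs_tau Ge Ke y = - (Ge y).1.
  by rewrite /S_rhs_tau mulrN mulrC divfK.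
split=> -[su e1 e2 i]; split => //.
- move=> [[t tau] y]; apply: (mulfI (a0 y)).
  by rewrite -system_t// e1 /S_rhs_t divff.
- move=> [[t tau] y]; apply: (mulfI (a0 y)).
  by rewrite -system_tau// e2 E.
- by move=> t tau y; rewrite system_t// (e1 (t, tau, y)) /S_rhs_t divff.
- by move=> t tau y; rewrite system_tau// (e2 (t, tau, y)) E.
Qed.

End Translation.

(** * Recovering the transported function *)

Section Reconstruction.
Context {R : realType} {n : nat}.
Notation Rn := 'rV[R]_n.
Variables (eps : R) (G K : Rn -> Rn) (omega f0 : Rn -> R) (Ge Ke : Rn -> R * Rn).
Hypothesis eps_gt0 : 0 < eps.
Hypothesis omega_gt0 : forall y, 0 < omega y.
Hypothesis f0_smooth : smooth f0.
Hypothesis F_flow : generates_flow (transport_field eps omega G K).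
Hypothesis sGe : smooth Ge.
Hypothesis sKe : smooth Ke.
Hypothesis decomposition : forall y, Fcheck eps omega G K y = eps^-1 *: Ge y + Ke y.
Hypothesis commutation : forall Y, lie_bracket (augmented Ge) (augmented Ke) Y = 0.
Hypothesis Ge_flow : generates_2pi_periodic_flow (augmented Ge).
Hypothesis a0 : forall y, (Ke y).1 != 0.
Hypothesis t_flow : generates_flow (t_field Ke).
Hypothesis tau_flow : generates_flow (tau_field Ge Ke).

Let X := t_field Ke.
Let Z := tau_field Ge Ke.
Let p := S_rhs_t Ke.
Let q := S_rhs_tau Ge Ke.

Lemma decomposition_t y : (omega y)^-1 = eps^-1 * (Ge y).1 + (Ke y).1.
Proof.
by have := congr1 fst (decomposition y); rewrite /= [eps^-1 *: 0]mulr0 add0r.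
Qed.

(** Following the original field, S grows at the rate omega, that is, as fast
    as eps tau. *)
Lemma transport_rate y : p y + omega y / eps * q y = omega y.
Proof.
rewrite /p /q /S_rhs_t /S_rhs_tau.
have d := decomposition_t y; have w0 : omega y != 0 by rewrite gt_eqF.
have e0 : eps != 0 by rewrite gt_eqF.
have -> : (Ge y).1 = eps * ((omega y)^-1 - (Ke y).1) by rewrite d addrK mulrA divff// mul1r.
by field; rewrite e0 w0 a0.
Qed.

(** The original field follows t at speed 1 and the fast phase tau at speed
    omega / eps. *)
Lemma transport_fieldE y : transport_field eps omega G K y = X y + (omega y / eps) *: Z y.
Proof.
have w0 : omega y != 0 by rewrite gt_eqF.
have e0 : eps != 0 by rewrite gt_eqF.
have d2 : eps^-1 *: G y + (omega y)^-1 *: K y = eps^-1 *: (Ge y).2 + (Ke y).2.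
  exact: (congr1 snd (decomposition y)).
have -> : transport_field eps omega G K y =
    omega y *: (eps^-1 *: G y + (omega y)^-1 *: K y).
  by rewrite /transport_field scalerDr !scalerA divff// scale1r [eps^-1 * _]mulrC.
rewrite d2 /X /Z /t_field /tau_field.
have h := transport_rate y; move: h; rewrite /p /q /S_rhs_t /S_rhs_tau => h.
apply/rowP => i; rewrite !mxE mulrDr -[X in _ + X * _]h.
by ring.
Qed.

(** The left-hand side is the tau-derivative of eps tau - S, up to the point
    at which it is evaluated. *)
Lemma tau_rate y : eps - q y = eps / (omega y * (Ke y).1).
Proof.
have d := decomposition_t y; have w0 : omega y != 0 by rewrite gt_eqF.
have e0 : eps != 0 by rewrite gt_eqF.
rewrite /q /S_rhs_tau.
have -> : (Ge y).1 = eps * ((omega y)^-1 - (Ke y).1) by rewrite d addrK mulrA divff// mul1r.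
by field; rewrite w0 a0.
Qed.

(** Along a closed orbit of Ge the variable t returns to its value, so the
    first component of Ge vanishes somewhere; there the first component of Ke
    is 1 / omega > 0. As it never vanishes, it is positive along the whole
    orbit. *)
Lemma Ke1_gt0 y : 0 < (Ke y).1.
Proof.
have [Phi [_ Phi0 dPhi] per] := Ge_flow.
pose P s := Phi s (0, y).
have P0 : P 0 = (0, y) by exact: Phi0.
have Pc : P (2 * pi) = (0, y) by rewrite -P0 /P -(per 0) add0r.
have dP s : is_derive s (1 : R) P (Ge (P s).2) by exact: dPhi.
have d1 s : is_derive s (1 : R) (fun s => (P s).1) (Ge (P s).2).1.
  exact: is_derive_fst.
have pi2 : 0 < 2 * pi :> R by rewrite mulr_gt0// pi_gt0.
have [c c01 cE] : exists2 c, c \in `]0, (2 * pi)[%R &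
    (P (2 * pi)).1 - (P 0).1 = (Ge (P c).2).1 * (2 * pi - 0).
  apply: (@MVT _ (fun s => (P s).1) (fun s => (Ge (P s).2).1)) => //.
  apply: derivable_within_continuous => s _.
  exact: (@ex_derive _ _ _ _ _ _ _ (d1 s)).
have gc0 : (Ge (P c).2).1 = 0.
  move/esym/eqP: cE; rewrite Pc P0 /= !subr0 mulf_eq0 (gt_eqF pi2) orbF.
  by move/eqP.
have apos : 0 < (Ke (P c).2).1.
  by have := decomposition_t (P c).2; rewrite gc0 mulr0 add0r => <-; rewrite invr_gt0.
rewrite ltNge; apply/negP => aneg.
have ca : continuous (fun s => (Ke (P s).2).1).
  move=> s; apply/differentiable_continuous.
  apply: (@differentiable_comp _ _ _ _ P (fun Y => (Ke Y.2).1)).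
    by apply/derivable1_diffP; exact: (@ex_derive _ _ _ _ _ _ _ (dP s)).
  apply: smooth_diff; apply: smooth_fst; apply: smooth_comp => //.
    exact: coordinatized_rV.
  exact/smooth_snd/smooth_id.
have [|||z _ zE] := @IVT _ (fun s => (Ke (P s).2).1) 0 c 0.
- by rewrite ltW// (itvP c01).
- exact: continuous_subspaceT.
- by rewrite P0 /= ge_min aneg le_max (ltW apos) orbT.
by have := a0 (P z).2; rewrite zE eqxx.
Qed.

Lemma tau_rate_gt0 y : 0 < eps - q y.
Proof. by rewrite tau_rate divr_gt0// mulr_gt0// Ke1_gt0. Qed.

Lemma h_unique_periodic : exists h, [/\ solves_h_system Ge Ke f0 h,
    forall h', solves_h_system Ge Ke f0 h' -> h' = h & tau_periodic h].
Proof.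
have [phi fphi] := t_flow; have [psi fpsi] := tau_flow.
have [Phi fPhi per] := Ge_flow.
have sX : smooth X by exact: smooth_t_field.
have sZ : smooth Z by exact: smooth_tau_field.
have [|u hu _] := solves_exists (p := fun=> 0) (q := fun=> 0) sX sZ
  (smooth_cst _) (smooth_cst _) f0_smooth (commuting_fields sGe sKe a0 commutation) _ fphi fpsi.
  by move=> y; rewrite !derive_cst.
exists (curry3 u); split.
- by apply/(solves_hP _ a0); rewrite curry3K.
- move=> h' /(solves_hP _ a0) hh'; apply: uncurry3_inj; rewrite curry3K.
  exact: (solves_unique fphi fpsi hu hh').
- move=> t tau y; apply: (solves_periodic (Ge := Ge) _ _ fPhi per hu).
    exact: Ge2E.
  by move=> z; rewrite mulr0 addr0.
Qed.

(** Besides the claims on S, this records that eps tau - S is increasing in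
    tau: its tau-derivative is eps / (omega a) at the point reached backwards
    from (t, tau, y). *)
Lemma S_unique_periodic : exists S, [/\ solves_S_system Ge Ke S,
    forall S', solves_S_system Ge Ke S' -> S' = S, tau_periodic S &
    forall t tau y, 0 < eps - 'D_(((0 : R), (1 : R)), (0 : Rn)) (uncurry3 S) (t, tau, y)].
Proof.
have [phi fphi] := t_flow; have [psi fpsi] := tau_flow.
have [Phi fPhi per] := Ge_flow.
have sX : smooth X by exact: smooth_t_field.
have sZ : smooth Z by exact: smooth_tau_field.
have sp : smooth p by exact: smooth_S_rhs_t.
have sq : smooth q by exact: smooth_S_rhs_tau.
have [|u hu Du] := solves_exists sX sZ sp sq (smooth_cst 0)
  (commuting_fields sGe sKe a0 commutation) _ fphi fpsi.
  exact: S_rhs_compatible.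
exists (curry3 u); split.
- by apply/(solves_SP _ a0); rewrite curry3K.
- move=> S' /(solves_SP _ a0) hS'; apply: uncurry3_inj; rewrite curry3K.
  exact: (solves_unique fphi fpsi hu hS').
- move=> t tau y; apply: (solves_periodic (Ge := Ge) _ _ fPhi per hu).
    exact: Ge2E.
  by move=> z; rewrite /p /q /S_rhs_t /S_rhs_tau subrr.
- by move=> t tau y; rewrite curry3K Du// tau_rate_gt0.
Qed.

(** The relation that defines tau is W = 0. *)
Let W (S : R -> R -> Rn -> R) (P : (R * Rn) * R) : R := eps * P.2 - S P.1.1 P.2 P.1.2.

Lemma smooth_W S : smooth (uncurry3 S) -> smooth (W S).
Proof.
move=> sS; apply: smoothB.
  by apply: smoothM; [exact: smooth_cst|exact/smooth_snd/smooth_id].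
apply: (smooth_comp (f := fun P : (R * Rn) * R => (P.1.1, P.2, P.1.2)) (g := uncurry3 S)) => //.
  exact: coordinatized_time2.
have s1 : smooth (fun P : (R * Rn) * R => P.1) by exact/smooth_fst/smooth_id.
apply: smooth_pair; last exact: smooth_snd.
by apply: smooth_pair; [exact: smooth_fst|exact/smooth_snd/smooth_id].
Qed.

Lemma derive_W S P : smooth (uncurry3 S) ->
  'D_((0 : R * Rn), (1 : R)) (W S) P =
  eps - 'D_(((0 : R), (1 : R)), (0 : Rn)) (uncurry3 S) (P.1.1, P.2, P.1.2).
Proof.
move=> sS; have sW := smooth_W sS.
case: P => -[t y] tau /=.
have d1 : is_derive tau (1 : R) (fun s => W S ((t, y), s))
    ('D_((0 : R * Rn), (1 : R)) (W S) ((t, y), tau)).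
  apply: (is_derive_curve (c := fun s : R => ((t, y), s)) (u := W S)); first exact: smooth_diff.
  by apply: is_derive_pair.
have d2 : is_derive tau (1 : R) (fun s => W S ((t, y), s))
    (eps - 'D_(((0 : R), (1 : R)), (0 : Rn)) (uncurry3 S) (t, tau, y)).
  apply: is_deriveB.
    by under eq_fun do rewrite mulrC; exact: is_derive_mulr.
  apply: (is_derive_curve (c := fun s : R => (t, s, y)) (u := uncurry3 S)).
    exact: smooth_diff.
  by apply: is_derive_pair; apply: is_derive_pair.
by rewrite -(@derive_val _ _ _ _ _ _ _ d1) (@derive_val _ _ _ _ _ _ _ d2).
Qed.

(** S is bounded in tau by periodicity, so eps tau - S takes both signs. *)
Lemma W_root S : smooth (uncurry3 S) -> tau_periodic S -> forall x, exists s, W S (x, s) = 0.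
Proof.
move=> sS per [t y].
have perN N tau : S t (tau + (2 * pi) * N%:R) y = S t tau y.
  elim: N => [|N IH]; first by rewrite mulr0 addr0.
  by rewrite -[N.+1%:R]natr1 mulrDr mulr1 addrA per.
have pi2 : 0 < 2 * pi :> R by rewrite mulr_gt0// pi_gt0.
pose N := (Num.truncn (`|S t 0 y| / (eps * (2 * pi)))).+1.
pose T : R := (2 * pi) * N%:R.
have T0 : 0 <= T by rewrite mulr_ge0// ltW.
have NT : `|S t 0 y| < eps * T.
  have := truncnS_gt (`|S t 0 y| / (eps * (2 * pi))).
  rewrite ltr_pdivrMr ?mulr_gt0 ?pi_gt0// => h; by rewrite /T mulrA [_ * N%:R]mulrC.
have ST : S t T y = S t 0 y by rewrite -(perN N 0) add0r.
have SN : S t (- T) y = S t 0 y by rewrite -(perN N (- T)) addNr.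
have cW : continuous (fun s => W S ((t, y), s)).
  move=> s; apply/differentiable_continuous.
  apply: (@differentiable_comp _ _ _ _ (fun s : R => ((t, y), s)) (W S)).
    by apply: smooth_diff; apply: smooth_pair; [exact: smooth_cst|exact: smooth_id].
  exact/smooth_diff/smooth_W.
move: NT; rewrite ltr_norml => /andP[N1 N2].
have [|||z _ zE] := @IVT _ (fun s => W S ((t, y), s)) (- T) T 0.
- by rewrite -subr_ge0 opprK addr_ge0.
- exact: continuous_subspaceT.
- rewrite /W /= ST SN ge_min le_max; apply/andP; split; apply/orP; [left|right]; lra.
by exists z.
Qed.

Lemma transport_conserved f t y theta : is_flow (transport_field eps omega G K) theta ->
  solves_transport eps omega G K f0 f -> f t y = f0 (theta (- t) y).
Proof.
move=> fT [sf ef i]; have [_ T0 _] := fT.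
pose F := transport_field eps omega G K.
pose fh := fun P : R * Rn => f P.1 P.2.
have sfh : smooth fh := sf.
have D s z : 'D_((1 : R), F z) fh (s, z) = 0.
  have d1 : derive1 (fun s => f s z) s = 'D_((1 : R), (0 : Rn)) fh (s, z).
    rewrite derive1E.
    exact: (@derive_val _ _ _ _ _ _ _ (is_derive_slice (smooth_diff (s, z) sfh))).
  have d2 : dotp (F z) (grad (f s) z) = 'D_((0 : R), F z) fh (s, z).
    rewrite dotp_grad; last first.
      apply: (@differentiable_comp _ _ _ _ (fun y => (s, y)) fh); last exact: smooth_diff.
      by apply: smooth_diff; apply: smooth_pair; [exact: smooth_cst|exact: smooth_id].
    rewrite derive_lineE [RHS]derive_lineE.
    apply: (congr1 (fun f : R -> R => 'D_1 f 0)); apply/funext => r.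
    by rewrite /fh /=; congr (f _ _); rewrite [r *: 0]mulr0 add0r.
  rewrite derive_dir_split; last exact: smooth_diff.
  by rewrite -d1 -d2; exact: ef.
have dc s : is_derive s (1 : R) (fun s => fh (t - s, backflow theta (s, y))) 0.
  have db := backflow_derive_time y s fT.
  have dp := is_derive_pair (is_derive_subl t s) db.
  apply: (is_derive_eq (is_derive_curve (u := fh) (smooth_diff _ sfh) dp)).
  rewrite (_ : (- 1, - F _) = (-1 : R) *: ((1 : R), F (backflow theta (s, y)))); last first.
    by congr pair; rewrite /= ?scaleN1r.
  by rewrite derive_dirZ ?D ?scaler0//; exact: smooth_diff.
have := @is_derive_0_is_cst _ _ 0 t dc.
by rewrite /fh /= !subr0 subrr i /backflow /= oppr0 T0.
Qed.

(** W has exactly one zero tau (x) over each x. Along the trajectory of the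
    original field arriving at (t, y), differentiating W = 0 shows that tau
    moves at the rate omega / eps; in the variables (t, tau, y) this curve is
    a combination of the two characteristic directions of h, so h is constant
    along it. At time 0 the root is tau = 0, because S vanishes at (0, 0, y),
    and h is f0. *)
Lemma reconstruction f h S : solves_transport eps omega G K f0 f ->
  solves_h_system Ge Ke f0 h -> solves_S_system Ge Ke S ->
  exists tau : R * Rn -> R, [/\ smooth tau,
    forall x s, (eps * s = S x.1 s x.2) <-> (s = tau x) &
    forall t y, f t y = h t (tau (t, y)) y].
Proof.
move=> hf hh hS.
have [S' [_ uniS perS DS]] := S_unique_periodic.
have SE := uniS _ hS; rewrite -{}SE in perS DS uniS.
have [theta fT] := F_flow; have [_ T0 _] := fT.
have hhP := (solves_hP Ge a0 f0 h).1 hh; have hSP := (solves_SP Ge a0 S).1 hS.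
have [sS _ _ S0] := hSP; have [sh _ _ h0] := hhP.
have sW := smooth_W sS.
have cRn : coordinatized (R * Rn)%type by exact: coordinatized_time.
have W_gt0 P : 0 < 'D_((0 : R * Rn), (1 : R)) (W S) P by rewrite derive_W.
have roots := W_root sS perS.
pose tau x := projT1 (cid (roots x)).
have tauE x : W S (x, tau x) = 0 by exact: (projT2 (cid (roots x))).
have W_tau x s : W S (x, s) = 0 <-> s = tau x.
  split=> [Ws|->//].
  case: (ltgtP s (tau x)) => // /(slice_increasing sW W_gt0 x); by rewrite Ws tauE ltxx.
have stau : smooth tau by exact: (implicit_smooth cRn sW W_tau W_gt0).
exists tau; split=> // [x s|t y].
  by rewrite -W_tau /W /=; split=> [->|/subr0_eq//]; rewrite subrr.
rewrite (transport_conserved t y fT hf).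
pose Y s := backflow theta (s, y).
pose T s := tau (t - s, Y s).
have dY s : is_derive s (1 : R) Y (- transport_field eps omega G K (Y s)).
  exact: backflow_derive_time.
have dT s : is_derive s (1 : R) T
    ('D_((- 1 : R), - transport_field eps omega G K (Y s)) tau (t - s, Y s)).
  apply: (is_derive_curve (c := fun s => (t - s, Y s)) (u := tau)); first exact: smooth_diff.
  by apply: is_derive_pair; exact: is_derive_subl.
(* The curve follows -X - k Z but its tau-component has the unknown rate T'; the
   discrepancy T' + k is multiplied by the tau-derivative of W, which is not 0. *)
have rate s : 'D_((- 1 : R), - transport_field eps omega G K (Y s)) tau (t - s, Y s) =
    - (omega (Y s) / eps).
  set T' := 'D_(_, _) tau _; set k := omega (Y s) / eps.
  pose P := (t - s, T s, Y s); have dS : differentiable (uncurry3 S) P by exact: smooth_diff.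
  have dP : is_derive s (1 : R) (fun s => (t - s, T s, Y s))
      (((- 1 : R), T'), - transport_field eps omega G K (Y s)).
    by apply: is_derive_pair; apply: is_derive_pair; exact: is_derive_subl.
  have dW1 : is_derive s (1 : R) (fun s => eps * T s - uncurry3 S (t - s, T s, Y s))
      (eps * T' - 'D_(((- 1 : R), T'), - transport_field eps omega G K (Y s)) (uncurry3 S) P).
    by apply: is_deriveB; exact: (is_derive_curve dS dP).
  have dW2 : is_derive s (1 : R) (fun s => eps * T s - uncurry3 S (t - s, T s, Y s)) 0.
    rewrite (_ : (fun _ => _) = (fun=> 0)); first exact: is_derive_const.
    by apply/funext => r; exact: tauE (t - r, Y r).
  have := @derive_val _ _ _ _ _ _ _ dW1; rewrite (@derive_val _ _ _ _ _ _ _ dW2).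
  have -> : (((- 1 : R), T'), - transport_field eps omega G K (Y s)) =
      (((- 1 : R), - k), (- 1) *: X P.2 + (- k) *: Z P.2) +
      (T' + k) *: (((0 : R), (1 : R)), (0 : Rn)).
    rewrite transport_fieldE opprD scaleN1r scaleNr.
    congr ((_, _), _); rewrite /=.
    - by rewrite [_ *: 0]mulr0 addr0.
    - by rewrite [_ *: 1]mulr1 addrCA addNr addr0.
    - by rewrite scaler0 addr0.
  rewrite derive_dirD// derive_dirZ// (solves_along _ _ _ hSP) -/p -/q.
  have := W_gt0 ((t - s, Y s), T s); rewrite derive_W//= -/P.
  set St := 'D_(_, 0) _ _ => St0 e.
  have r : p (Y s) + k * q (Y s) = k * eps by rewrite transport_rate /k divfK// gt_eqF.
  have : (T' + k) * (eps - St) = 0.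
    rewrite [RHS]e; transitivity (eps * T' + (p (Y s) + k * q (Y s)) - (T' + k) * St).
      by rewrite r; ring.
    by rewrite -[_ *: St]/(_ * _); ring.
  move/eqP; rewrite mulf_eq0 (gt_eqF St0) orbF addr_eq0 => /eqP ->.
  by [].
have dh s : is_derive s (1 : R) (fun s => uncurry3 h (t - s, T s, Y s)) 0.
  have := dT s; rewrite rate => dT'.
  apply: (is_derive_eq (solves_curve hhP (is_derive_subl t s) dT' _)).
    by have := dY s; rewrite transport_fieldE opprD scaleN1r scaleNr.
  by rewrite !mulr0 addr0.
have := @is_derive_0_is_cst _ _ 0 t dh.
rewrite /uncurry3 /= /T /Y !subr0 subrr /backflow /= oppr0 T0 => ->.
have -> : tau (0, theta (- t) y) = 0.
  by apply/esym/W_tau; rewrite /W /= mulr0 sub0r; apply/eqP; rewrite oppr_eq0; apply/eqP/S0.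
exact/esym/h0.
Qed.

End Reconstruction.

Unset Implicit Arguments.
Set Strict Implicit.
Set Printing Implicit Defensive.

Theorem theorem5p2 (R : realType) (n : nat) (eps : R)
    (G K : 'rV[R]_n -> 'rV[R]_n) (omega f0 : 'rV[R]_n -> R)
    (Ge Ke : 'rV[R]_n -> R * 'rV[R]_n)
    (eps_gt0 : 0 < eps)
    (G_smooth : smooth G) (K_smooth : smooth K)
    (omega_smooth : smooth omega)
    (omega_ge : exists2 c : R, 0 < c & forall y, c <= omega y)
    (f0_smooth : smooth f0)
    (G_flow : generates_2pi_periodic_flow G)
    (F_flow : generates_flow (transport_field eps omega G K))
    (Fcheck_flow : generates_flow (augmented (Fcheck eps omega G K)))
    (Ge_smooth : smooth Ge) (Ke_smooth : smooth Ke)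
    (decomposition : forall y, Fcheck eps omega G K y = eps^-1 *: Ge y + Ke y)
    (commutation : forall Y, lie_bracket (augmented Ge) (augmented Ke) Y = 0)
    (Ge_flow : generates_2pi_periodic_flow (augmented Ge))
    (Ke_flow : generates_flow (augmented Ke))
    (Ke1_neq0 : forall y, (Ke y).1 != 0)
    (t_flow : generates_flow (t_field Ke))
    (tau_flow : generates_flow (tau_field Ge Ke)) :
  [/\ (exists h, [/\ solves_h_system Ge Ke f0 h,
                     forall h', solves_h_system Ge Ke f0 h' -> h' = h
                   & tau_periodic h]),
      (exists S, [/\ solves_S_system Ge Ke S,
                     forall S', solves_S_system Ge Ke S' -> S' = S
                   & tau_periodic S])
    & forall f h S,
        solves_transport eps omega G K f0 f ->
        solves_h_system Ge Ke f0 h ->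
        solves_S_system Ge Ke S ->
        let E (p : R * 'rV[R]_n) (s : R) := eps * s = S p.1 s p.2 in
        (forall p, exists U J tau, U p /\ implicit_function E U J tau) /\
        (forall U J tau, implicit_function E U J tau ->
           forall t y, U (t, y) -> f t y = h t (tau (t, y)) y)].
Proof.
have [c c_gt0 c_omega] := omega_ge.
have omega_gt0 y : 0 < omega y by exact: lt_le_trans c_gt0 (c_omega y).
split.
- exact: (h_unique_periodic f0_smooth Ge_smooth Ke_smooth commutation Ge_flow
    Ke1_neq0 t_flow tau_flow).
- have [S [hS uS pS _]] := S_unique_periodic eps_gt0 omega_gt0 Ge_smooth Ke_smooth
    decomposition commutation Ge_flow Ke1_neq0 t_flow tau_flow.
  by exists S.
- move=> f h S hf hh hS E.
  have [tau [tau_smooth tauE f_h]] := reconstruction eps_gt0 omega_gt0 F_flow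
    Ge_smooth Ke_smooth decomposition commutation Ge_flow Ke1_neq0 t_flow tau_flow
    hf hh hS.
  split=> [P|U J tau' [_ _ _ tauJ tau'E] t y Uty].
    exists setT, setT, tau; split=> //.
    by split; [exact: openT|exact: openT|exact: tau_smooth| |move=> x s _ _; exact: tauE].
  have /tauE -> : E (t, y) (tau' (t, y)) by apply/(tau'E _ _ Uty) => //; exact: tauJ.
  exact: f_h.
Qed.
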